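(* For every integer $d \ge 0$ there is a constant $K_d$ depending only on $d$ such that for every field $\mathbb{F}$, every $n \ge 1$, and every matrix $M$ (of any finite size) with entries in $\mathcal{M}_d$, $$\operatorname{PR}(M) \le \left(2^d + \frac{K_d}{|\mathbb{F}|}\right)\operatorname{CR}(M) \quad\text{and}\quad \operatorname{CR}(M) \le \left(1-\frac{1}{|\mathbb{F}|}\right)^{-d}\operatorname{MR}(M),$$ where $1/|\mathbb{F}|$ is interpreted as $0$ if $\mathbb{F}$ is infinite.
   Context: Let $\mathbb{F}$ be a field and let $x_i = (x_{i,1},\ldots,x_{i,n})$, $i = 1,\ldots,d$, be tuples of variables, where $n$ is an arbitrary (unbounded) parameter. For a finite set $S \subseteq [d] = \{1,\ldots,d\}$, $\mathcal{M}_S$ is the $\mathbb{F}$-vector space of multilinear forms over $\mathbb{F}$ that are linear in each $x_i$, $i \in S$, i.e. the $\mathbb{F}$-span of the monomials $\prod_{i\in S} x_{i,j_i}$ with $j_i \in [n]$ (so $\mathcal{M}_\emptyset = \mathbb{F}$), and $\mathcal{M}_d = \mathcal{M}_{[d]}$. An $\mathcal{M}_d$-matrix is a matrix with entries in $\mathcal{M}_d$; an $\mathcal{M}_S$-vector is a vector with entries in $\mathcal{M}_S$. For an $\mathcal{M}_d$-matrix $M$: - the max-rank $\operatorname{MR}(M)$ is the maximum rank of the scalar matrix $M(p_1,\ldots,p_d)$ over all $p_1,\ldots,p_d \in \mathbb{F}^n$; - the commutative rank $\operatorname{CR}(M)$ is the rank of $M$ as a matrix over the field of rational functions over $\mathbb{F}$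 in the variables $x_{i,j}$; - the partition rank $\operatorname{PR}(M)$ is the minimum $r$ such that $M$ is a sum of $r$ matrices, each of the form $u \otimes v$ (the matrix with $(a,b)$ entry $u_a v_b$), where $u$ is an $\mathcal{M}_S$-vector and $v$ is an $\mathcal{M}_{[d]\setminus S}$-vector for some $S \subseteq [d]$ (the set $S$ may vary between summands). *)

(* Defs.v *)
From HB Require Import structures.
From mathcomp Require Import all_boot all_order all_algebra.
From mathcomp Require Import fraction finmap boolp classical_sets cardinality.
From mathcomp Require Import mpoly.
Set Implicit Arguments.
Unset Strict Implicit.
Unset Printing Implicit Defensive.
Import Order.TTheory GRing.Theory Num.Theory.
Local Open Scope ring_scope.

(* The variable x_{i,j} is encoded as the variable of index [mxvec_index i j]
   among d * n variables, so that a tuple (p_1, ..., p_d) of points of F^n is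
   the d x n matrix with rows p_i and substitutes [mxvec p] for the variables. *)
Definition mlvar (F : fieldType) (d n : nat) (i : 'I_d) (j : 'I_n) :
  {mpoly F[d * n]} := 'X_(mxvec_index i j).

Definition mlmonomial (F : fieldType) (d n : nat) (S : {set 'I_d})
    (j : {ffun {i : 'I_d | i \in S} -> 'I_n}) : {mpoly F[d * n]} :=
  \prod_(i : {i : 'I_d | i \in S}) mlvar F (val i) (j i).

Definition multilinear (F : fieldType) (d n : nat) (S : {set 'I_d})
    (f : {mpoly F[d * n]}) : Prop :=
  exists c : {ffun {i : 'I_d | i \in S} -> 'I_n} -> F,
    f = \sum_(j : {ffun {i : 'I_d | i \in S} -> 'I_n}) c j *: mlmonomial F j.

Definition multilinear_mx (F : fieldType) (d n : nat) (S : {set 'I_d})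
    (a b : nat) (M : 'M[{mpoly F[d * n]}]_(a, b)) : Prop :=
  forall i j, multilinear S (M i j).

Definition eval_mx (F : fieldType) (d n a b : nat)
    (M : 'M[{mpoly F[d * n]}]_(a, b)) (p : 'M[F]_(d, n)) : 'M[F]_(a, b) :=
  map_mx (meval (fun k => mxvec p 0 k)) M.

Definition is_max_rank (F : fieldType) (d n a b : nat)
    (M : 'M[{mpoly F[d * n]}]_(a, b)) (r : nat) : Prop :=
  (exists p : 'M[F]_(d, n), \rank (eval_mx M p) = r) /\
  (forall p : 'M[F]_(d, n), (\rank (eval_mx M p) <= r)%N).

Definition max_rank (F : fieldType) (d n a b : nat)
    (M : 'M[{mpoly F[d * n]}]_(a, b)) : nat :=
  xget 0%N [set r | is_max_rank M r]%classic.

Definition commutative_rank (F : fieldType) (d n a b : nat)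
    (M : 'M[{mpoly F[d * n]}]_(a, b)) : nat :=
  \rank (map_mx (@tofrac {mpoly F[d * n]}) M).

(* u \otimes v is the product of the column u by the row v. *)
Definition partition_decomposition (F : fieldType) (d n a b : nat)
    (M : 'M[{mpoly F[d * n]}]_(a, b)) (r : nat) : Prop :=
  exists (S : 'I_r -> {set 'I_d})
         (u : 'I_r -> 'cV[{mpoly F[d * n]}]_a)
         (v : 'I_r -> 'rV[{mpoly F[d * n]}]_b),
    [/\ forall k, multilinear_mx (S k) (u k),
        forall k, multilinear_mx (~: S k) (v k)
      & M = \sum_(k < r) u k *m v k].

Definition is_partition_rank (F : fieldType) (d n a b : nat)
    (M : 'M[{mpoly F[d * n]}]_(a, b)) (r : nat) : Prop :=
  partition_decomposition M r /\
  (forall s, partition_decomposition M s -> (r <= s)%N).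

(* The default value 0 is only reached when M has no decomposition at all;
   see [partition_rankP]. *)
Definition partition_rank (F : fieldType) (d n a b : nat)
    (M : 'M[{mpoly F[d * n]}]_(a, b)) : nat :=
  xget 0%N [set r | is_partition_rank M r]%classic.

Definition inv_card (F : fieldType) : rat :=
  if `[< finite_set [set: F]%classic >]
  then (#|` fset_set [set: F]%classic |)%:R^-1 else 0.

Lemma max_rankP (F : fieldType) (d n a b : nat)
  (M : 'M[{mpoly F[d * n]}]_(a, b)) : is_max_rank M (max_rank M).
Proof.
rewrite /max_rank; case: xgetP => [r _ //|noM].
pose P r := `[< exists p : 'M[F]_(d, n), \rank (eval_mx M p) = r >].
have exP : exists r, P r.
  by exists (\rank (eval_mx M 0)); apply/asboolP; exists 0.
have leP r : P r -> (r <= a)%N.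
  by move=> /asboolP[p <-]; apply: rank_leq_row.
case: (ex_maxnP exP leP) => r /asboolP Pr maxr.
case: (noM r); split=> // p.
by apply: maxr; apply/asboolP; exists p.
Qed.

Lemma multilinear0 (F : fieldType) (d n : nat) (c : F) :
  multilinear (@finset.set0 'I_d) (c%:MP_[d * n]).
Proof.
have e0 (i : {i : 'I_d | i \in finset.set0}) : False.
  by case: i => i; rewrite finset.in_set0.
have f0 : {ffun {i : 'I_d | i \in finset.set0} -> 'I_n}.
  by apply: finfun => i; case: (e0 i).
exists (fun=> c); rewrite (big_pred1 f0) => [|g]; last first.
  by apply/esym/eqP/ffunP => i; case: (e0 i).
rewrite /mlmonomial big1 => [|i _]; last by case: (e0 i).
by rewrite -mul_mpolyC mulr1.
Qed.

Lemma partition_rankP (F : fieldType) (d n a b : nat)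
  (M : 'M[{mpoly F[d * n]}]_(a, b)) :
  multilinear_mx [set: 'I_d]%SET M -> is_partition_rank M (partition_rank M).
Proof.
move=> Mml; rewrite /partition_rank; case: xgetP => [r _ //|noM].
have exP : exists r, `[< partition_decomposition M r >].
  exists a; apply/asboolP.
  exists (fun=> finset.set0), (fun k => delta_mx k 0), (fun k => row k M); split.
  - move=> k i j; rewrite mxE.
    by rewrite -mpolyC_nat; apply: multilinear0.
  - by move=> k i j; rewrite mxE finset.setC0; apply: Mml.
  apply/matrixP => i j; rewrite summxE (bigD1 i) //= big1 => [|k ki].
    by rewrite !mxE big_ord1 !mxE !eqxx mul1r addr0.
  by rewrite !mxE big_ord1 !mxE eq_sym (negPf ki) mul0r.
case: (ex_minnP exP) => r /asboolP Pr minr.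
by case: (noM r); split=> // s Ps; apply: minr; apply/asboolP.
Qed.

(* Main.v *)
Require Import Defs.
From HB Require Import structures.
From mathcomp Require Import boolp classical_sets cardinality finmap.
From mathcomp Require Import all_boot all_order all_fingroup all_algebra.
Set Implicit Arguments.
Unset Strict Implicit.
Unset Printing Implicit Defensive.
Import Order.TTheory GRing.Theory Num.Theory.
From mathcomp Require Import mpoly zify ring fraction qpoly qfpoly.
Local Open Scope ring_scope.

(* CR <= (1 - 1/q)^-d MR: evaluate M at the generic point and replace the generic tuples
   x_1, ..., x_d one after the other by points of F^n.  Each step multiplies the rank by at
   least 1 - 1/q, because the corank of a matrix of linear forms at a point is at most
   the multiplicity there of the zero of a maximal minor, and a Schwartz-Zippel bound with
   multiplicities gives a point of F^n where that multiplicity is at most 1/q times the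
   degree of the minor.

   PR: let p be such a point, r = rank M(p), and choose scalar matrices X, Y such that
   Y M(p) X = 1.  Put T = M(p + x), A = Y T X, and let Z be the truncated geometric series
   of A^-1.  The component of multidegree (1, ..., 1) of
     T = (T X Z)(Y T) + (T - T X Z Y T)
   is M = (sum over S of 2^d products of an M_S-matrix with r columns and
   an M_(~S)-matrix with r rows) + E.  Up to terms of degree > d, T - T X Z Y T is the Schur
   complement T - T X A^-1 Y T, of rank at most CR(M) - r; an alternating sum over
   the substitutions x_i := 0 isolates E as its lowest-order term, so that
   CR(E) <= 2^d (CR(M) - r) = O(CR(M) / q).  Iterating bounds PR by 2^(d+1) CR over large
   fields, and by C CR over all fields after boundedly many quadratic extensions, each of
   which costs a factor 2.  One more elimination, with this crude bound applied to E, gives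
   the theorem. *)

(** * Schwartz-Zippel with multiplicities *)

(** Vanishing to order a + 1 at s means divisibility by (X - s)^(a+1). These powers are coprime, and
    their product has too large a degree to divide a nonzero g. *)
Lemma hermite_eq0 (L : fieldType) (S : seq L) (a : nat) (g : {poly L}) :
  uniq S -> (size g <= size S * a.+1)%N ->
  (forall s b, s \in S -> (b <= a)%N -> (g \Po ('X + s%:P))`_b = 0) -> g = 0.
Proof.
move=> uS sg g0; apply: contraTeq sg => gn0; rewrite -ltnNge.
have dvds s : s \in S -> ('X - s%:P) ^+ a.+1 %| g.
  move=> sS; have: 'X^(a.+1) %| g \Po ('X + s%:P).
    apply/dvdpP; exists (drop_poly a.+1 (g \Po ('X + s%:P))).
    rewrite -[LHS](poly_take_drop a.+1) [take_poly _ _](_ : _ = 0) ?add0r //.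
    by apply/polyP => b; rewrite coef_take_poly coef0; case: ltnP => // /g0->.
  case/dvdpP => h /(congr1 (comp_poly ('X - s%:P))).
  by rewrite comp_polyXaddC_K comp_polyM comp_Xn_poly => ->; apply: dvdp_mulIr.
have: \prod_(s <- S) ('X - s%:P) ^+ a.+1 %| g.
  elim: S uS dvds {g0} => [|s S IH] /=; first by rewrite big_nil dvd1p.
  case/andP=> sS uS dvds; rewrite big_cons Gauss_dvdp ?dvds ?mem_head ?IH //.
    by move=> t tS; rewrite dvds // inE tS orbT.
  rewrite big_seq; apply: (big_ind (coprimep _)); rewrite ?coprimep1 //.
    by move=> x y; rewrite coprimepMr => -> ->.
  move=> t tS; rewrite coprimep_expl // coprimep_expr // coprimep_XsubC root_XsubC.
  by apply: contraNneq sS => <-.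
move/(dvdp_leq gn0); apply: leq_trans.
set P := \prod_(s <- S) ('X - s%:P).
have sP : size P = (size S).+1 by rewrite size_prod_XsubC.
rewrite prodrXl -/P; have := size_exp P a.+1; rewrite sP /= => <-.
by rewrite prednK // size_poly_gt0 expf_neq0 // -size_poly_gt0 sP.
Qed.

(* The linear form sending a polynomial of degree at most e to its coefficient
   of degree e is a combination of Hasse derivatives of order at most e / #|S|
   at the points of S. *)
Lemma hermite_dual (L : fieldType) (S : seq L) (e a : nat) :
  uniq S -> (e < size S * a.+1)%N ->
  exists c : 'I_(size S) -> 'I_a.+1 -> L, forall k, (k <= e)%N ->
    \sum_s \sum_b c s b * (('X + (S`_s)%:P) ^+ k)`_b = (k == e)%:R.
Proof.
move=> uS lte.
(* Row k of [W] lists the Taylor coefficients of X^k at the points of [S]. The rows are independent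
   by [hermite_eq0]; the last column of a right inverse is [c]. *)
pose W : 'M[L]_(e.+1, size S * a.+1) := \matrix_(k < e.+1)
  mxvec (\matrix_(s < size S, b < a.+1) (('X + (S`_s)%:P) ^+ k)`_b).
have/row_freeP[W' WW'] : row_free W.
  rewrite -kermx_eq0; apply/rowV0P => v /sub_kermxP vW.
  suff: rVpoly v = 0 by move=> v0; rewrite -[v]rVpolyK v0 linear0.
  apply: (hermite_eq0 uS (a := a)) => [|s b sS ba].
    exact: leq_trans (size_poly _ _) lte.
  have ltS : (index s S < size S)%N by rewrite index_mem.
  transitivity ((v *m W) 0 (mxvec_index (Ordinal ltS) (inord b : 'I_a.+1))).
    rewrite !mxE /rVpoly poly_def raddf_sum coef_sum; apply: eq_bigr => i _.
    rewrite /= comp_polyZ comp_Xn_poly coefZ valK !mxE mxvecE mxE.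
    by rewrite /= nth_index // inordK.
  by rewrite vW mxE.
exists (fun s b => W' (mxvec_index s b) ord_max) => k ke.
have := congr1 (fun z : 'M_ _ => z (inord k) ord_max) WW'.
rewrite !mxE -val_eqE /= inordK // => <-; rewrite pair_bigA /=.
rewrite (reindex _ (curry_mxvec_bij _ _)) /=; apply: eq_bigr => -[s b] _ /=.
by rewrite !mxE mxvecE mxE mulrC inordK.
Qed.

Lemma mcoeff_prod_horner (L : fieldType) n (g : 'I_n -> {poly L}) (m : 'X_{1..n}) :
  (\prod_i (map_poly (@mpolyC n L) (g i)).['X_i])@_m = \prod_i (g i)`_(m i).
Proof.
pose N := (\max_i maxn (size (g i)) (m i).+1)%N.
have [leN ltN] : (forall i, size (g i) <= N)%N /\ (forall i, m i < N)%N.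
  by split=> i; apply: leq_trans (leq_bigmax i); rewrite ?leq_maxl ?leq_maxr.
rewrite (eq_bigr (fun i => \sum_(b < N) (g i)`_b *: 'X_i ^+ b)) => [|i _]; last first.
  rewrite (horner_coef_wide (n := N)); last exact: leq_trans (size_poly _ _) (leN i).
  by apply: eq_bigr => b _; rewrite coef_map /= mul_mpolyC.
rewrite bigA_distr_bigA /= raddf_sum (bigD1 [ffun i => Ordinal (ltN i)]) //=.
rewrite [X in _ + X]big1 => [|f fm]; rewrite scaler_prod mcoeffZ.
  rewrite addr0 [X in _ * X](_ : _ = 1) ?mulr1.
    by apply: eq_bigr => i _; rewrite ffunE.
  transitivity ('X_[L, m]@_m); last by rewrite mcoeffX eqxx.
  rewrite mpolyXE_id; congr (_@_m).
  by apply: eq_bigr => i _; rewrite ffunE.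
suff -> : \prod_(i < n) 'X_i ^+ f i = 'X_[[multinom (f i : nat) | i < n]] :> {mpoly L[n]}.
  rewrite mcoeffX [_ == m]negbTE ?mulr0 //; apply: contra fm => /eqP fm.
  by apply/eqP/ffunP => i; rewrite ffunE; apply: val_inj; rewrite /= -fm mnmE.
by rewrite mpolyXE_id; apply: eq_bigr => i _; rewrite mnmE.
Qed.

(** The substitution x := x + p: the coefficients of the shifted polynomial are the Hasse
    derivatives at p. *)
Definition mshift (R : comNzRingType) n (p : 'I_n -> R) : n.-tuple {mpoly R[n]} :=
  [tuple 'X_i + (p i)%:MP | i < n].

Lemma mcoeff_mshift (L : fieldType) n (f : {mpoly L[n]}) (p : 'I_n -> L)
    (m : 'X_{1..n}) :
  (f \mPo mshift p)@_m
  = \sum_(k <- msupp f) f@_k * \prod_i (('X + (p i)%:P) ^+ k i)`_(m i).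
Proof.
rewrite comp_mpolyEX raddf_sum; apply: eq_bigr => k _ /=.
rewrite mcoeffZ comp_mpolyX -mcoeff_prod_horner; congr (_ * _@__).
by apply: eq_bigr => i _; rewrite tnth_mktuple !rmorphE /= map_polyX map_polyC /= !hornerE.
Qed.

(* A Schwartz-Zippel bound counting multiplicities: the coefficient of the
   leading monomial of f is a combination of Hasse derivatives of f at the points of S^n
   (tensor product of the forms of [hermite_dual]). *)
Lemma mshift_mcoeff_neq0 (L : fieldType) n (f : {mpoly L[n]}) (S : seq L) :
  f != 0 -> uniq S -> (0 < size S)%N ->
  exists2 p : 'I_n -> L, forall i, p i \in S &
  exists2 m : 'X_{1..n},
    (size S * mdeg m <= mdeg (mlead f))%N & (f \mPo mshift p)@_m != 0.
Proof.
move=> fn0 uS S0; set e := mlead f; set q := size S in S0 *.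
pose N := (\max_i (e i %/ q).+1)%N.
(* Orders up to e_i / q suffice in coordinate i, which gives the degree bound. Padding with zeros up
   to [N] makes the index type independent of i. *)
have exC i : exists C : 'I_q * 'I_N -> L,
    (forall j, C j != 0 -> (q * j.2 <= e i)%N) /\
    forall k, (k <= e i)%N ->
      \sum_j C j * (('X + (S`_j.1)%:P) ^+ k)`_j.2 = (k == e i)%:R.
    have lte : (e i < size S * (e i %/ q).+1)%N by rewrite mulnC ltn_ceil.
    have [c cP] := hermite_dual uS lte.
    have leN : ((e i %/ q).+1 <= N)%N by apply: leq_bigmax.
    exists (fun j : 'I_q * 'I_N => if (j.2 < (e i %/ q).+1)%N then c j.1 (inord j.2) else 0); split.
      by move=> [s b] /=; case: ifP; rewrite ?eqxx // mulnC -leq_divRL.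
    move=> k /cP <-.
    rewrite -(pair_bigA _ (fun s (b : 'I_N) => (if (b < (e i %/ q).+1)%N then c s (inord b)
      else 0) * (('X + (S`_s)%:P) ^+ k)`_b)) /=; apply: eq_bigr => s _.
    under [RHS]eq_bigr do rewrite -[X in c s X]inord_val.
    rewrite (big_ord_widen _ (fun b => c s (inord b) * (('X + (S`_s)%:P) ^+ k)`_b) leN).
    by rewrite [RHS]big_mkcond; apply: eq_bigr => b _; case: ifP => //; rewrite mul0r.
have [C CP] := fin_all_exists exC.
pose p (phi : {ffun 'I_n -> 'I_q * 'I_N}) i := S`_(phi i).1.
pose m (phi : {ffun 'I_n -> 'I_q * 'I_N}) := [multinom ((phi i).2 : nat) | i < n].
have : \sum_(phi : {ffun 'I_n -> 'I_q * 'I_N})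
    (\prod_i C i (phi i)) * (f \mPo mshift (p phi))@_(m phi) = f@_e.
  under eq_bigr do rewrite mcoeff_mshift mulr_sumr.
  rewrite exchange_big /= (bigD1_seq e) ?msupp_uniq ?mlead_supp //=.
  have sumE k : \sum_(phi : {ffun 'I_n -> 'I_q * 'I_N}) (\prod_i C i (phi i)) *
      (f@_k * \prod_i (('X + (p phi i)%:P) ^+ k i)`_(m phi i))
    = f@_k * \prod_i \sum_j C i j * (('X + (S`_j.1)%:P) ^+ k i)`_j.2.
    rewrite bigA_distr_bigA mulr_sumr; apply: eq_bigr => phi _.
    rewrite mulrCA -big_split; congr (_ * _); apply: eq_bigr => i _.
    by rewrite mnmE.
  rewrite sumE big1 => [|i _]; last by have [_ ->] := CP i; rewrite ?eqxx.
  rewrite mulr1 big_seq_cond big1 ?addr0 // => k /andP[kf ke].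
  (* The monomial order refines the degree, so k has degree at most that of e and is smaller in some
     coordinate i. The factor at i vanishes, whatever the other exponents of k. *)
  have [i lti] : exists i, (k i < e i)%N.
    apply/existsP; apply: contraR ke; rewrite negb_exists => /forallP le_ek.
    have {}le_ek i : (e i <= k i)%N by rewrite leqNgt.
    have : (mdeg k <= mdeg e)%N by apply/lemc_mdeg/msupp_le_mlead.
    rewrite !mdegE => le_sum; apply/eqP/mnmP => i.
    have/leqif_sum[_] : forall i, true -> (e i <= k i ?= iff (e i == k i))%N.
      by move=> j _; split.
    rewrite eqn_leq le_sum leq_sum // => /esym/forallP/(_ i)/eqP-> //.
  rewrite sumE (bigD1 i) //=; have [_ ->] := CP i; last exact: ltnW.
  by rewrite ltn_eqF // mul0r mulr0.
have [/existsP[phi /andP[Cn0 fphi]] _|] := boolP [exists phi : {ffun 'I_n -> 'I_q * 'I_N},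
    (\prod_i C i (phi i) != 0) && ((f \mPo mshift (p phi))@_(m phi) != 0)].
  exists (p phi); first by move=> i; apply: mem_nth.
  exists (m phi); rewrite // !mdegE big_distrr /=; apply: leq_sum => i _.
  rewrite mnmE; have [le_e _] := CP i; apply: le_e.
  by apply: contraNneq Cn0 => Ci0; rewrite (bigD1 i) //= Ci0 mul0r.
rewrite negb_exists => /forallP all0; rewrite big1 => [/esym/eqP|phi _].
  by rewrite mleadc_eq0 (negPf fn0).
by apply/eqP; move: (all0 phi); rewrite -negb_or -mulf_eq0 negbK.
Qed.

(** * Ranks on grids *)

(** The zero of f at the origin has multiplicity at least k; f = 0 satisfies this for every k. *)
Definition morder_ge (R : nzRingType) n (k : nat) (f : {mpoly R[n]}) :=
  forall m, m \in msupp f -> (k <= mdeg m)%N.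

Lemma morder_ge_prod (R : comNzRingType) n r (k : 'I_r -> nat)
    (f : 'I_r -> {mpoly R[n]}) :
  (forall i, morder_ge (k i) (f i)) -> morder_ge (\sum_i k i) (\prod_i f i).
Proof.
move=> ord_f; apply: (big_ind2 (fun k f => morder_ge k f)) => //.
move=> k1 f1 k2 f2 ord1 ord2 m /msuppM_le/allpairsP[[m1 m2] /= [m1f m2f ->]].
by rewrite mdegD leq_add ?ord1 ?ord2.
Qed.

Lemma dhomog_prod_ord (R : comNzRingType) n r (f : 'I_r -> {mpoly R[n]}) :
  (forall i, f i \is 1.-homog) -> \prod_i f i \is r.-homog.
Proof.
elim: r f => [|r IH] f hom_f; first by rewrite big_ord0 dhomog1.
by rewrite big_ord_recl; apply: (dhomogM (hom_f ord0) (IH _ (fun i => hom_f _))).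
Qed.

Lemma dhomog_det (R : comNzRingType) n r (N : 'M[{mpoly R[n]}]_r) :
  (forall i j, N i j \is 1.-homog) -> \det N \is r.-homog.
Proof.
by move=> homN; apply: rpred_sum => s _; rewrite rpredMsign dhomog_prod_ord.
Qed.

(** Invertible row operations make all but rank B rows of B zero. In those zero rows only linear
    forms remain, so every Leibniz term has order at least r - rank B. *)
Lemma morder_ge_det (L : fieldType) n r (B : 'M[L]_r) (N : 'M[{mpoly L[n]}]_r) :
  (forall i j, N i j \is 1.-homog) ->
  morder_ge (r - \rank B) (\det (map_mx (@mpolyC n L) B + N)).
Proof.
move=> homN; pose P := invmx (col_ebase B).
have uP : P \in unitmx by rewrite unitmx_inv col_ebase_unit.
have PB : P *m B = pid_mx (\rank B) *m row_ebase B.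
  by rewrite -{1}[B]mulmx_ebase !mulmxA mulVmx ?col_ebase_unit // mul1mx.
suff ordP : morder_ge (r - \rank B) (\det P *: \det (map_mx (@mpolyC n L) B + N)).
  move=> m mf; apply: ordP; rewrite (perm_mem (msuppZ _ _)) //.
  by rewrite -unitfE -unitmxE.
rewrite -mul_mpolyC -det_map_mx /= -det_mulmx mulmxDr -map_mxM PB.
have sumE k rB : (\sum_(i < k) (rB <= i) = k - rB)%N.
  elim: k => [|k IH]; first by rewrite big_ord0.
  by rewrite big_ord_recr /= IH; case: leqP => [/subSn->|]; lia.
move=> m /msupp_sum_le/flattenP[_ /mapP[s _ ->]].
have ordN (i : 'I_r) : morder_ge (\rank B <= i)
    ((map_mx (@mpolyC n L) (pid_mx (\rank B) *m row_ebase B)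
       + map_mx (@mpolyC n L) P *m N) i (s i)).
  case: leqP => // le_i m' /=; rewrite mxE [X in X + _](_ : _ = 0) ?add0r.
    suff /dhomogP h : (map_mx (@mpolyC n L) P *m N) i (s i) \is 1.-homog by move=> /h->.
    by rewrite mxE rpred_sum // => k _; rewrite mxE mul_mpolyC dhomogZ.
  rewrite !mxE big1 // => k _; rewrite !mxE ltnNge le_i andbF mul0r //.
have := morder_ge_prod ordN; rewrite sumE => ord_prod.
by rewrite -signr_odd; case: odd; rewrite ?expr1 ?expr0 ?mulN1r ?mul1r;
  rewrite ?(perm_mem (msuppN _)); apply: ord_prod.
Qed.

Lemma row_col_normal (L : fieldType) a b (M : 'M[L]_(a, b)) :
  exists Y X, Y *m M *m X = 1%:M :> 'M_(\rank M).
Proof.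
have/row_fullP[Y YM] := col_base_full M; have/row_freeP[X MX] := row_base_free M.
have: Y *m (col_base M *m row_base M) *m X = 1%:M by rewrite mulmxA YM mul1mx.
by rewrite mulmx_base; exists Y, X.
Qed.

(** Compression by Y and X gives an r x r matrix equal to 1 at y, so the determinant of the generic
    combination is a nonzero form of degree r. Its multiplicity at p bounds the corank there. *)
Lemma rank_grid (L : fieldType) a b n (A : 'I_n -> 'M[L]_(a, b)) (y : 'I_n -> L)
    (S : seq L) (r := \rank (\sum_i y i *: A i)%R) :
  uniq S -> (0 < size S)%N ->
  exists2 p : 'I_n -> L, forall i, p i \in S &
    (size S * (r - \rank (\sum_i p i *: A i)%R) <= r)%N.
Proof.
move=> uS S0; have [Y [X YX]] := row_col_normal (\sum_i y i *: A i).
rewrite -/r in Y X YX; pose A' i := Y *m A i *m X.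
have AE z : \sum_i z i *: A' i = Y *m (\sum_i z i *: A i) *m X.
  by rewrite mulmx_sumr mulmx_suml; apply: eq_bigr => i _; rewrite -scalemxAr -scalemxAl.
pose N : 'M[{mpoly L[n]}]_r := \sum_i 'X_i *: map_mx (@mpolyC n L) (A' i).
have homN i j : N i j \is 1.-homog.
  rewrite summxE rpred_sum // => k _; rewrite !mxE mulrC mul_mpolyC dhomogZ //.
  by rewrite dhomogX /= mdeg1.
have f0 : \det N != 0.
  apply: contra_eq_neq (det1 L r) => N0; rewrite -YX -AE.
  suff -> : \sum_i y i *: A' i = map_mx (meval y) N
    by rewrite det_map_mx N0 raddf0 eq_sym oner_neq0.
  rewrite raddf_sum; apply: eq_bigr => i _; apply/matrixP => j k.
  by rewrite !mxE /= mevalM mevalXU mevalC.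
have [p pS [m le_m fm]] := mshift_mcoeff_neq0 f0 uS S0.
exists p => //.
have deg_f : mdeg (mlead (\det N)) = r.
  by have /dhomogP := dhomog_det homN; apply; apply: mlead_supp.
rewrite deg_f in le_m; apply: leq_trans le_m; rewrite leq_mul2l; apply/orP; right.
apply: leq_trans (leq_sub2l r (_ : \rank (\sum_i p i *: A' i)%R <= _)%N) _.
  by rewrite AE (leq_trans (mxrankM_maxl _ _)) ?mxrankM_maxr.
apply: (morder_ge_det homN); rewrite mcoeff_msupp.
(* Shifting by p turns the matrix of linear forms into its value at p plus itself, as
   [morder_ge_det] requires. *)
suff -> : map_mx (@mpolyC n L) (\sum_i p i *: A' i) + N
    = map_mx (comp_mpoly (mshift p)) N by rewrite det_map_mx.
rewrite !raddf_sum -big_split; apply: eq_bigr => i _; apply/matrixP => j k /=.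
rewrite !mxE /= (rmorphM (comp_mpoly (mshift p))) /= comp_mpolyXU comp_mpolyC
  -tnth_nth tnth_mktuple.
by rewrite mulrDl addrC mpolyCM.
Qed.

(** * Replacing generic tuples by grid points, one at a time *)

Definition set_row (L : Type) d n (y : 'M[L]_(d, n)) (i : 'I_d) (p : 'I_n -> L) :=
  \matrix_(i', j) if i' == i then p j else y i' j.

(** Each monomial contains exactly one variable of the i-th tuple, so the value is linear in row i.
    The field L accommodates rows that are still generic. *)
Lemma multilinear_set_row (F L : fieldType) (iota : {rmorphism F -> L}) d n
    (f : {mpoly F[d * n]}) (y : 'M[L]_(d, n)) (i : 'I_d) (p : 'I_n -> L) :
  multilinear [set: 'I_d] f ->
  mmap iota (fun k => mxvec (set_row y i p) 0 k) f
  = \sum_j p j * mmap iota (fun k => mxvec (set_row y i (fun j' => (j' == j)%:R)) 0 k) f.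
Proof.
case=> c ->.
have mmapE z : mmap iota (fun k => mxvec z 0 k) (\sum_J c J *: mlmonomial F J)
    = \sum_(J : {ffun {i : 'I_d | i \in [set: 'I_d]} -> 'I_n})
        iota (c J) * \prod_s z (val s) (J s).
  rewrite raddf_sum; apply: eq_bigr => J _; rewrite /= mmapZ rmorph_prod.
  by congr (_ * _); apply: eq_bigr => s _; rewrite /= mmapX mmap1U mxvecE.
rewrite mmapE; under [RHS]eq_bigr do rewrite mmapE mulr_sumr.
rewrite exchange_big; apply: eq_bigr => J _ /=.
have i_all : i \in [set: 'I_d] by rewrite in_setT.
pose s := exist (fun i : 'I_d => i \in [set: 'I_d]) i i_all.
pose P := \prod_(t : {i : 'I_d | i \in [set: 'I_d]} | t != s) y (val t) (J t).
have prodE q : \prod_t set_row y i q (val t) (J t) = q (J s) * P.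
  rewrite (bigD1 s) //= mxE eqxx; congr (_ * _); apply: eq_bigr => t ts.
  by rewrite mxE; case: eqP => // ti; case/eqP: ts; apply: val_inj.
rewrite prodE; under eq_bigr do rewrite prodE.
rewrite [RHS](bigD1 (J s)) // [X in _ = _ + X]big1 => [|j /negPf js].
  by rewrite eqxx mul1r addr0 mulrCA.
by rewrite eq_sym js mul0r !mulr0.
Qed.

Section Evaluation.
Variables (F L : fieldType) (iota : {rmorphism F -> L}) (d n a b : nat).
Variable M : 'M[{mpoly F[d * n]}]_(a, b).
Hypothesis Mml : multilinear_mx [set: 'I_d] M.

Let ev (y : 'M[L]_(d, n)) := map_mx (mmap iota (fun k => mxvec y 0 k)) M.

Lemma rank_set_row (S : seq F) (y : 'M[L]_(d, n)) (i : 'I_d) :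
  uniq S -> (0 < size S)%N ->
  exists2 p : 'I_n -> L, forall j, p j \in map iota S &
    (size S * (\rank (ev y) - \rank (ev (set_row y i p))) <= \rank (ev y))%N.
Proof.
move=> uS S0.
have evE p : ev (set_row y i p)
    = \sum_j p j *: ev (set_row y i (fun j' => (j' == j)%:R)).
  apply/matrixP => k l; rewrite mxE summxE multilinear_set_row //.
  by apply: eq_bigr => j _; rewrite !mxE.
have uS' : uniq (map iota S) by rewrite map_inj_uniq //; apply: fmorph_inj.
have [|p pS] := rank_grid (fun j => ev (set_row y i (fun j' => (j' == j)%:R)))
  (y i) uS'; first by rewrite size_map.
rewrite -!evE size_map; have -> : set_row y i (y i) = y.
  by apply/matrixP => i' j; rewrite mxE; case: eqP => // ->.
by move=> le_r; exists p.
Qed.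

(** Iterates [rank_set_row] over the rows. The multiplicative estimate serves the max-rank, the
    additive one (loss at most d c / q) the partition rank. *)
Lemma rank_eval_mx_ge (S : seq F) (y : 'M[L]_(d, n))
    (q := size S) (c := \rank (ev y)) :
  uniq S -> (0 < q)%N ->
  exists p : 'M[F]_(d, n),
    (q.-1 ^ d * c <= q ^ d * \rank (eval_mx M p))%N /\
    (q * c <= q * \rank (eval_mx M p) + d * c)%N.
Proof.
move=> uS q0.
have chain k : (k <= d)%N -> exists2 z : 'M[L]_(d, n),
    forall (i : 'I_d) j, (i < k)%N -> z i j \in map iota S &
    (q.-1 ^ k * c <= q ^ k * \rank (ev z))%N /\
    (q * c <= q * \rank (ev z) + k * c)%N.
  elim: k => [|k IH] ltk; first by exists y; rewrite // !expn0; split; lia.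
  have [z zS [le1 le2]] := IH (ltnW ltk).
  have [p pS le_p] := rank_set_row z (Ordinal ltk) uS q0.
  exists (set_row z (Ordinal ltk) p).
    move=> i j; rewrite ltnS leq_eqVlt mxE -val_eqE /= => /orP[->//|lti].
    by rewrite ltn_eqF // zS.
  move: le_p le1 le2; rewrite -/q; set t := \rank (ev z); set t' := \rank _.
  move=> le_p le1 le2; rewrite !expnS; split; last by nia.
  have: (q.-1 * t <= q * t')%N by nia.
  move: (q ^ k)%N (q.-1 ^ k)%N le1 => Q Q' *; nia.
have [z zS [le1 le2]] := chain d (leqnn d).
have [p zE] : exists p : 'M[F]_(d, n), z = map_mx iota p.
  have ex i : exists pi : {ffun 'I_n -> F}, forall j, z i j = iota (pi j).
    have [|f fP] := @fin_all_exists _ (fun=> F) (fun j x => z i j = iota x).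
      by move=> j; have /mapP[x _ ->] := zS i j (ltn_ord i); exists x.
    by exists (finfun f) => j; rewrite ffunE fP.
  have [f fP] := fin_all_exists ex.
  by exists (\matrix_(i, j) f i j); apply/matrixP => i j; rewrite !mxE fP.
exists p; suff evz : ev z = map_mx iota (eval_mx M p) by rewrite evz mxrank_map in le1 le2.
apply/matrixP => i j; rewrite zE !mxE /meval /mmap raddf_sum; apply: eq_bigr => m _.
rewrite /= rmorphM /mmap1 rmorph_prod; congr (_ * _); apply: eq_bigr => k _.
by rewrite -map_mxvec mxE rmorphXn.
Qed.

End Evaluation.

Lemma commutative_rank_grid (F : fieldType) d n a b
    (M : 'M[{mpoly F[d * n]}]_(a, b)) (S : seq F)
    (q := size S) (c := commutative_rank M) :
  multilinear_mx [set: 'I_d] M -> uniq S -> (0 < q)%N ->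
  exists p : 'M[F]_(d, n),
    (q.-1 ^ d * c <= q ^ d * \rank (eval_mx M p))%N /\
    (q * c <= q * \rank (eval_mx M p) + d * c)%N.
Proof.
move=> Mml uS q0.
pose iota : {rmorphism F -> _} := (@tofrac {mpoly F[d * n]} \o @mpolyC (d * n) F).
(* The starting point is the generic one, whose coordinates are the variables themselves; there M
   evaluates to itself. *)
have [p] := rank_eval_mx_ge iota Mml (\matrix_(i, j) tofrac (mlvar F i j)) uS q0.
rewrite (_ : map_mx _ M = map_mx (@tofrac _) M); first by exists p.
apply/matrixP => i j; rewrite !mxE [in RHS](mpolyE (M i j)) raddf_sum.
apply: eq_bigr => m _; rewrite /= -mul_mpolyC rmorphM mpolyXE_id rmorph_prod.
congr (_ * _); apply: eq_bigr => k _; case/mxvec_indexP: k => i' j'.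
by rewrite mxvecE mxE rmorphXn.
Qed.

(** * Multidegree components *)

Definition mblock d n (m : 'X_{1..d * n}) (i : 'I_d) : nat :=
  \sum_j m (mxvec_index i j).

Lemma mdeg_mblock d n (m : 'X_{1..d * n}) : mdeg m = (\sum_i mblock m i)%N.
Proof.
by rewrite mdegE pair_bigA (reindex _ (curry_mxvec_bij _ _)); apply: eq_bigr => -[].
Qed.

Lemma mblockD d n (m1 m2 : 'X_{1..d * n}) i :
  mblock (m1 + m2) i = (mblock m1 i + mblock m2 i)%N.
Proof. by rewrite -big_split; apply: eq_bigr => j _; rewrite mnmDE. Qed.

Lemma eq_mxvec_index d n (i i' : 'I_d) (j j' : 'I_n) :
  (mxvec_index i j == mxvec_index i' j') = (i == i') && (j == j').
Proof. by rewrite (inj_eq (@cast_ord_inj _ _ _)) (inj_eq enum_rank_inj). Qed.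

Lemma mblock1 d n (i i' : 'I_d) (j : 'I_n) :
  mblock U_(mxvec_index i j) i' = (i == i').
Proof.
rewrite /mblock; under eq_bigr do rewrite mnm1E eq_mxvec_index.
case: eqP => _ /=; last by rewrite big1.
by rewrite (bigD1 j) //= eqxx big1 // => j' /negPf; rewrite eq_sym => ->.
Qed.

Definition mlmnm d n (S : {set 'I_d}) (m : 'X_{1..d * n}) :=
  [forall i, mblock m i == (i \in S)].

(** When the product has multidegree (1, ..., 1), S must be the set of tuples occurring in the first
    factor, so exactly one term survives. *)
Lemma mlmnmD d n (m1 m2 : 'X_{1..d * n}) (R : nmodType) (x : R) :
  \sum_S (if mlmnm S m1 && mlmnm (~: S) m2 then x else 0)
  = if mlmnm [set: 'I_d] (m1 + m2) then x else 0.
Proof.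
case: ifP => [/forallP m12|m12]; last first.
  rewrite big1 // => S _; case: ifP => // /andP[/forallP m1S /forallP m2S].
  case/negP: m12; apply/forallP => i; rewrite mblockD (eqP (m1S i)) (eqP (m2S i)).
  by rewrite !inE; case: (i \in S).
have {}m12 i : (mblock m1 i + mblock m2 i = 1)%N.
  by rewrite -mblockD (eqP (m12 i)) inE.
rewrite (bigD1 [set i | mblock m1 i == 1%N]) //= big1 => [|S neS].
  rewrite [X in if X then _ else _](_ : _ = true) ?addr0 //.
  by apply/andP; split; apply/forallP => i; rewrite !inE; move: (m12 i); case: eqP; lia.
case: ifP => // /andP[/forallP m1S _]; case/eqP: neS; apply/setP => i.
by rewrite inE (eqP (m1S i)); case: (i \in S).
Qed.

Section Component.
Variables (F : fieldType) (d n : nat).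
Implicit Types (S : {set 'I_d}) (f g : {mpoly F[d * n]}).

Definition mlpart S f : {mpoly F[d * n]} :=
  \sum_(m <- msupp f | mlmnm S m) f@_m *: 'X_[m].

Lemma mcoeff_mlpart S f m : (mlpart S f)@_m = if mlmnm S m then f@_m else 0.
Proof.
rewrite raddf_sum /=; under eq_bigr do rewrite mcoeffZ mcoeffX.
have [mf|/memN_msupp_eq0 fm] := boolP (m \in msupp f); last first.
  rewrite fm if_same big1_seq // => k _; case: eqP => [->|_]; rewrite ?fm ?mul0r ?mulr0 //.
rewrite big_mkcond (bigD1_seq m) ?msupp_uniq //= eqxx mulr1 big1 ?addr0 // => k /negPf->.
by rewrite mulr0 if_same.
Qed.

Lemma mlpart_is_linear S : linear (mlpart S).
Proof.
move=> c f g; apply/mpolyP => m; rewrite mcoeffD mcoeffZ !mcoeff_mlpart.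
by case: ifP; rewrite ?mulr0 ?addr0 // mcoeffD mcoeffZ.
Qed.

HB.instance Definition _ S :=
  GRing.isLinear.Build F {mpoly F[d * n]} {mpoly F[d * n]} _ (mlpart S)
    (mlpart_is_linear S).

Lemma mlpartX S m : mlpart S 'X_[m] = if mlmnm S m then 'X_[m] else 0.
Proof.
apply/mpolyP => k; rewrite mcoeff_mlpart mcoeffX.
case: ifP => Sk; case: ifP => Sm; rewrite ?mcoeffX ?mcoeff0 //.
  by case: eqP => // mk; rewrite -mk Sm in Sk.
by case: eqP => // mk; rewrite -mk Sm in Sk.
Qed.

(** Bilinearity reduces this to monomials, that is to [mlmnmD]. The sum over S is the source of the
    factor 2^d in the theorem. *)
Lemma mlpartM f g :
  mlpart [set: 'I_d] (f * g) = \sum_S mlpart S f * mlpart (~: S) g.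
Proof.
have partE S h : mlpart S h = \sum_(m <- msupp h) h@_m *: mlpart S 'X_[m].
  by rewrite {1}[h]mpolyE linear_sum; apply: eq_bigr => m _; rewrite linearZ.
rewrite {1}[f]mpolyE {1}[g]mpolyE mulr_suml linear_sum /=.
under [RHS]eq_bigr => S _ do rewrite partE mulr_suml.
rewrite exchange_big; apply: eq_bigr => m1 _; rewrite mulr_sumr linear_sum /=.
under [RHS]eq_bigr => S _ do rewrite [mlpart (~: S) g]partE mulr_sumr.
rewrite exchange_big; apply: eq_bigr => m2 _ /=.
under [RHS]eq_bigr => S _ do rewrite -scalerAl -scalerAr.
rewrite -scalerAl -scalerAr !linearZ /= -mpolyXD mlpartX -!scaler_sumr; congr (_ *: (_ *: _)).
rewrite -(mlmnmD _ _ ('X_[m1 + m2])); apply: eq_bigr => S _.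
by rewrite !mlpartX mpolyXD; do 2!case: (mlmnm _ _); rewrite /= ?mul0r ?mulr0.
Qed.

Lemma multilinear_lincomb (I : Type) (r : seq I) (P : pred I) S (c : I -> F)
    (f : I -> {mpoly F[d * n]}) :
  (forall i, P i -> multilinear S (f i)) ->
  multilinear S (\sum_(i <- r | P i) c i *: f i).
Proof.
move=> fml; apply: big_ind => [|g h [cg ->] [ch ->]|i /fml[ci ->]].
- by exists (fun=> 0); rewrite big1 // => J _; rewrite scale0r.
- by exists (fun J => cg J + ch J); rewrite -big_split; apply: eq_bigr => J _;
    rewrite scalerDl.
by exists (fun J => c i * ci J); rewrite scaler_sumr; apply: eq_bigr => J _;
  rewrite scalerA.
Qed.

Lemma mlmonomialE S (J : {ffun {i : 'I_d | i \in S} -> 'I_n}) :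
  mlmonomial F J = 'X_[\sum_s U_(mxvec_index (val s) (J s))].
Proof. by rewrite /mlmonomial (big_morph _ (@mpolyXD _ _) (@mpolyX0 _ _)). Qed.

Lemma mlmnm_mlmonomial S (J : {ffun {i : 'I_d | i \in S} -> 'I_n}) :
  mlmnm S (\sum_s U_(mxvec_index (val s) (J s)))%MM.
Proof.
apply/forallP => i.
rewrite (big_morph (fun m : 'X_{1..d * n} => mblock m i)
  (fun m1 m2 => mblockD m1 m2 i) (_ : _ = 0%N)); last first.
  by rewrite /mblock big1 // => j _; rewrite mnm0E.
under eq_bigr do rewrite mblock1.
have [iS|iS] := boolP (i \in S).
  rewrite (bigD1 (exist _ i iS)) //= eqxx big1 // => s.
  by case: (val s =P i) => // si; case/eqP; apply: val_inj.
by rewrite big1 // => s _; case: (val s =P i) => // si; move: iS; rewrite -si (valP s).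
Qed.

Lemma multilinear_mnm S m : mlmnm S m -> multilinear S ('X_[m] : {mpoly F[d * n]}).
Proof.
move=> /forallP mS.
have exJ (s : {i : 'I_d | i \in S}) :
    exists j, forall j', m (mxvec_index (val s) j') = (j == j').
  have /eqP := mS (val s); rewrite (valP s) /= => m1.
  have [j mj] : exists j, (0 < m (mxvec_index (val s) j))%N.
    apply/existsP; apply: contra_eqT m1; rewrite negb_exists => /forallP m0.
    by rewrite /mblock big1 // => j _; apply/eqP; rewrite -leqn0 leqNgt m0.
  exists j => j'; move: m1; rewrite /mblock (bigD1 j) //=.
  rewrite /= in mj *; have [<-|jj'] := eqVneq; first by lia.
  by rewrite (bigD1 j') 1?eq_sym //=; lia.
have [J JP] := fin_all_exists exJ.
suff -> : 'X_[m] = mlmonomial F (finfun J).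
  exists (fun J' => (J' == finfun J)%:R).
  rewrite (bigD1 (finfun J)) //= eqxx scale1r big1 ?addr0 // => J' /negPf->.
  by rewrite scale0r.
rewrite mlmonomialE; congr mpolyX; apply/mnmP => k.
case/mxvec_indexP: k => i j; rewrite mnm_sumE.
under eq_bigr => s _ do rewrite mnm1E eq_mxvec_index ffunE.
have [iS|iS] := boolP (i \in S).
  rewrite (bigD1 (exist _ i iS)) //= eqxx /= -JP big1 ?addn0 // => s.
  by case: (val s =P i) => // si; case/eqP; apply: val_inj.
rewrite big1 => [|s _]; last first.
  by case: (val s =P i) => // si; move: iS; rewrite -si (valP s).
have /eqP/esym/eqP := mS i; rewrite (negPf iS) /mblock eq_sym.
by rewrite sum_nat_eq0 => /forallP/(_ j)/eqP.
Qed.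

Lemma multilinear_mlpart S f : multilinear S (mlpart S f).
Proof. by apply: multilinear_lincomb => m /multilinear_mnm. Qed.

Lemma multilinearP S f :
  multilinear S f <-> forall m, m \in msupp f -> mlmnm S m.
Proof.
split=> [[c ->] m /msupp_sum_le/flattenP[_ /mapP[J _ ->]]|ml_f].
  by move/msuppZ_le; rewrite mlmonomialE msuppX inE => /eqP->; apply: mlmnm_mlmonomial.
by rewrite [f]mpolyE big_seq; apply: multilinear_lincomb => m /ml_f/multilinear_mnm.
Qed.

Lemma mlmnm_mdeg (m : 'X_{1..d * n}) : mlmnm [set: 'I_d] m -> mdeg m = d.
Proof.
move=> /forallP ml_m; rewrite mdeg_mblock -[RHS]card_ord -sum1_card.
by apply: eq_bigr => i _; rewrite (eqP (ml_m i)) inE.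
Qed.

(** Passing to f(x + p) changes f only by terms of degree below d, and multidegree (1, ..., 1) has
    total degree d. *)
Lemma mlpart_mshift f (p : 'I_(d * n) -> F) :
  multilinear [set: 'I_d] f -> mlpart [set: 'I_d] (f \mPo mshift p) = f.
Proof.
move=> /multilinearP ml_f; apply/mpolyP => m; rewrite mcoeff_mlpart.
case: ifPn => ml_m; last first.
  by apply/esym/memN_msupp_eq0; apply: contra ml_m; apply: ml_f.
have coefD0 k l c : (l <= k)%N -> (('X + c%:P) ^+ l : {poly F})`_k = (l == k)%:R.
  rewrite -[c]opprK polyCN leq_eqVlt => /orP[/eqP<-|ltk].
    by rewrite eqxx -[RHS](monicP (monic_exp l (monicXsubC (- c)))) lead_coefE size_exp_XsubC.
  by rewrite nth_default ?ltn_eqF // size_exp_XsubC.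
rewrite mcoeff_mshift; under eq_big_seq => k kf.
  have -> : \prod_i (('X + (p i)%:P) ^+ k i)`_(m i) = (k == m)%:R; last over.
  have [<-|km] := eqVneq k m; first by rewrite big1 // => i _; rewrite coefD0 ?eqxx.
  have [i lti] : exists i, (k i < m i)%N.
    apply/existsP; apply: contraR km; rewrite negb_exists => /forallP le_mk.
    have {}le_mk i : true -> (m i <= k i ?= iff (m i == k i))%N.
      by move=> _; split; rewrite // leqNgt.
    have := leqif_sum le_mk.
    rewrite -!mdegE (mlmnm_mdeg (ml_f _ kf)) (mlmnm_mdeg ml_m).
    by case=> _; rewrite eqxx => /esym/forallP mk; apply/eqP/mnmP => i; have /eqP := mk i.
  by rewrite (bigD1 i) //= coefD0 1?ltnW // ltn_eqF // mul0r.
have [mf|/memN_msupp_eq0 fm] := boolP (m \in msupp f).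
  rewrite (bigD1_seq m) ?msupp_uniq //= eqxx mulr1 big1 ?addr0 // => k /negPf->.
  by rewrite mulr0.
by rewrite fm big1 // => k _; case: eqP => [->|_]; rewrite ?fm ?mul0r ?mulr0.
Qed.

End Component.

(** * Ranks over fraction fields *)

Lemma rank_mxsub (K : fieldType) a b k l (f : 'I_k -> 'I_a) (g : 'I_l -> 'I_b)
    (M : 'M[K]_(a, b)) : (\rank (mxsub f g M) <= \rank M)%N.
Proof.
have -> : mxsub f g M = rowsub f (rowsub g M^T)^T.
  by apply/matrixP => i j; rewrite !mxE.
apply: leq_trans (mxrankS (rowsub_sub _ _)) _.
by rewrite mxrank_tr -(mxrank_tr M) mxrankS ?rowsub_sub.
Qed.

Lemma rank_minor (K : fieldType) a b (M : 'M[K]_(a, b)) :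
  exists (f : 'I_(\rank M) -> 'I_a) (g : 'I_(\rank M) -> 'I_b),
    \det (mxsub f g M) != 0.
Proof.
have full : row_full (rowsub (maxrankfun M) M)^T.
  by rewrite /row_full mxrank_tr; apply: maxrowsub_free.
exists (maxrankfun M), (fullrankfun full).
have := fullrowsub_unit full; rewrite unitmxE unitfE -det_tr.
by congr (\det _ != 0); apply/matrixP => i j; rewrite !mxE.
Qed.

Definition fracrank (R : idomainType) a b (M : 'M[R]_(a, b)) : nat :=
  \rank (map_mx (@tofrac R) M).

(** A nonzero minor of the image comes from a nonzero minor of M. Injectivity of [phi] is not
    assumed, so this covers evaluations. *)
Lemma fracrank_map (R R' : idomainType) (phi : {rmorphism R -> R'}) a b
    (M : 'M[R]_(a, b)) : (fracrank (map_mx phi M) <= fracrank M)%N.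
Proof.
have [f [g]] := rank_minor (map_mx (@tofrac R') (map_mx phi M)).
rewrite -!map_mxsub !det_map_mx /= tofrac_eq0 => det_n0.
have {}det_n0 : \det (mxsub f g M) != 0.
  by apply: contra_neq det_n0 => ->; rewrite rmorph0.
apply: leq_trans (rank_mxsub f g _); rewrite -map_mxsub.
by rewrite mxrank_unit // unitmxE unitfE det_map_mx tofrac_eq0.
Qed.

Lemma fracrankD (R : idomainType) a b (M N : 'M[R]_(a, b)) :
  (fracrank (M + N) <= fracrank M + fracrank N)%N.
Proof. by rewrite /fracrank map_mxD mxrank_add. Qed.

Lemma fracrankZ (R : idomainType) a b (x : R) (M : 'M[R]_(a, b)) :
  (fracrank (x *: M) <= fracrank M)%N.
Proof. by rewrite /fracrank map_mxZ mxrank_scale. Qed.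

Lemma fracrankZ_nz (R : idomainType) a b (x : R) (M : 'M[R]_(a, b)) :
  x != 0 -> fracrank (x *: M) = fracrank M.
Proof. by move=> x0; rewrite /fracrank map_mxZ mxrank_scale_nz ?tofrac_eq0. Qed.

Lemma fracrank_sum (R : idomainType) (I : finType) a b (M : I -> 'M[R]_(a, b)) k :
  (forall i, (fracrank (M i) <= k)%N) -> (fracrank (\sum_i M i)%R <= #|I| * k)%N.
Proof.
move=> le_k; rewrite -sum_nat_const.
apply: (big_ind2 (fun x y => fracrank x <= y)%N) => [|x1 x2 y1 y2 le1 le2|i _ //].
  by rewrite /fracrank map_mx0 mxrank0.
exact: leq_trans (fracrankD _ _) (leq_add le1 le2).
Qed.

(** The Schur complement annihilates X while Y M X is invertible, so its row space meets that of Y M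
    only in 0; both lie in the row space of M. *)
Lemma rank_schur (K : fieldType) a b r (M : 'M[K]_(a, b)) (Y : 'M_(r, a))
    (X : 'M_(b, r)) : Y *m M *m X \in unitmx ->
  (\rank (M - M *m X *m invmx (Y *m M *m X) *m (Y *m M))%R + r <= \rank M)%N.
Proof.
move=> uA; set A := Y *m M *m X in uA *; set N := M - _.
have rYM : \rank (Y *m M) = r.
  apply/eqP; rewrite eqn_leq rank_leq_row /=.
  by apply: leq_trans (mxrankM_maxl (Y *m M) X); rewrite mxrank_unit.
have NX : N *m X = 0.
  rewrite mulmxBl -(mulmxA _ (Y *m M) X) -/A -(mulmxA _ (invmx A)) mulVmx //.
  by rewrite mulmx1 subrr.
have cap0 : (N :&: (Y *m M))%MS = 0.
  apply/eqP/rowV0P => w; rewrite sub_capmx => /andP[/submxP[u ->] /submxP[v uv]].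
  have vA : v *m A = 0 by rewrite mulmxA -uv -mulmxA NX mulmx0.
  by rewrite uv -[v](mulmxK uA) vA !mul0mx.
rewrite -[X in (_ + X)%N]rYM -(mxrank_disjoint_sum cap0) mxrankS // addsmx_sub.
rewrite submxMl andbT /N -[X in (X - _ <= _)%MS]mul1mx mulmxA -mulmxBl submxMl //.
Qed.

(** The Schur complement with denominators cleared, by A^-1 = adj A / det A. *)
Lemma fracrank_schur (R : idomainType) a b r (M : 'M[R]_(a, b)) (Y : 'M_(r, a))
    (X : 'M_(b, r)) (A := Y *m M *m X) : \det A != 0 ->
  (fracrank (\det A *: M - M *m X *m \adj A *m (Y *m M))%R + r <= fracrank M)%N.
Proof.
move=> A0; pose t := @tofrac R.
have EA : map_mx t A = map_mx t Y *m map_mx t M *m map_mx t X by rewrite -!map_mxM.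
have uA : map_mx t A \in unitmx by rewrite unitmxE unitfE det_map_mx tofrac_eq0.
have := uA; rewrite {1}EA => /rank_schur; rewrite -EA; apply: leq_trans.
rewrite leq_add2r -(mxrank_scale_nz _ (_ : t (\det A) != 0)) ?tofrac_eq0 //.
rewrite /invmx uA det_map_mx -map_mx_adj scalerBr -scalemxAr -scalemxAl scalerA.
by rewrite divff ?tofrac_eq0 // scale1r /fracrank map_mxB map_mxZ !map_mxM.
Qed.

(** * Extraction of the multilinear part by an alternating sum *)

Section AlternatingSum.
Variables (F : fieldType) (d n : nat).
Local Notation P := {mpoly F[d * n]}.
Implicit Types (B : {set 'I_d}) (f : P) (m : 'X_{1..d * n}).

(* The substitution x_i := s x_i for i in B and x_i := 0 otherwise, where s is the
   variable of {poly P}. *)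
Definition scale_blocks B : P -> {poly P} :=
  mmap (polyC \o @mpolyC (d * n) F) (fun k => mxvec (\matrix_(i < d, j < n)
    (if i \in B then (mlvar F i j)%:P * 'X else 0)) 0 k).

HB.instance Definition _ B := GRing.RMorphism.on (scale_blocks B).

Lemma scale_blocksZ B c f : scale_blocks B (c *: f) = c%:MP *: scale_blocks B f.
Proof. by rewrite /scale_blocks mmapZ mul_polyC. Qed.

Lemma scale_blocksX B m : scale_blocks B 'X_[m] =
  if [forall i, (i \in B) || (mblock m i == 0%N)]
  then 'X_[m] *: 'X^(mdeg m) else 0.
Proof.
rewrite /scale_blocks mmapX /mmap1; case: ifPn => [/forallP mB|].
  rewrite -mul_polyC mpolyXE_id rmorph_prod mdegE -GRing.prodrXr -big_split.
  apply: eq_bigr => k _; case/mxvec_indexP: k => i j; rewrite mxvecE mxE.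
  case/orP: (mB i) => [->|]; first by rewrite exprMn rmorphXn.
  by rewrite sum_nat_eq0 => /forallP/(_ j)/eqP->; rewrite !expr0 /= mulr1.
rewrite negb_forall => /existsP[i]; rewrite negb_or => /andP[iB].
rewrite sum_nat_eq0 negb_forall => /existsP[j /= mij].
rewrite (bigD1 (mxvec_index i j)) //= mxvecE mxE (negPf iB) expr0n.
by rewrite (negPf mij) mul0r.
Qed.

Lemma coef0_scale_blocks B f : (scale_blocks B f)`_0 = (f@_0%MM)%:MP.
Proof.
rewrite [f in LHS]mpolyE raddf_sum coef_sum /=.
have [f0|/memN_msupp_eq0 f0] := boolP (0%MM \in msupp f); last first.
  rewrite f0 big1_seq => [|m /= mf]; first by rewrite mpolyC0.
  rewrite scale_blocksZ coefZ scale_blocksX; case: ifP => _; last by rewrite coef0 mulr0.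
  rewrite coefZ coefXn eq_sym mdeg_eq0; case: eqP => [m0|]; last by rewrite !mulr0.
  by rewrite m0 f0 mpolyC0 mul0r.
rewrite (bigD1_seq 0%MM) ?msupp_uniq //= big1 => [|m m0].
  by rewrite scale_blocksZ mpolyX0 rmorph1 coefZ coef1 mulr1 addr0.
rewrite scale_blocksZ coefZ scale_blocksX; case: ifP => _; last by rewrite coef0 mulr0.
by rewrite coefZ coefXn eq_sym mdeg_eq0 (negPf m0) !mulr0.
Qed.

(** The inclusion-exclusion sign (-1)^(d - #|B|), as a product so that the sum over B factors. *)
Definition block_sign B : P := \prod_i (if i \in B then 1 else -1).

(** The coefficient is a product over the tuples, with factor 1 - 1 at each tuple absent from m. *)
Lemma alternating_sumX m :
  \sum_B block_sign B *: scale_blocks B 'X_[m]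
  = if [forall i, (0 < mblock m i)%N] then 'X_[m] *: 'X^(mdeg m) else 0.
Proof.
under eq_bigr => B _ do rewrite scale_blocksX.
transitivity ((\prod_i (1 + (if mblock m i == 0%N then -1 else 0)))
    *: ('X_[m] *: 'X^(mdeg m)) : {poly P}).
  rewrite bigA_distr scaler_suml; apply: eq_bigr => B _; case: ifPn => [/forallP mB|].
    congr (_ *: _); apply: eq_bigr => i _; case: ifP => // iB.
    by move: (mB i); rewrite iB => /= ->.
  rewrite negb_forall scaler0 => /existsP[i]; rewrite negb_or => /andP[/negPf iB /negPf mi].
  by rewrite (bigD1 i) //= iB mi mul0r scale0r.
case: ifPn => [/forallP m0|]; last first.
  rewrite negb_forall => /existsP[i]; rewrite -eqn0Ngt => mi.
  by rewrite (bigD1 i) //= mi subrr mul0r scale0r.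
by rewrite big1 ?scale1r // => i _; rewrite eqn0Ngt m0 addr0.
Qed.

(** A monomial involving all d tuples has degree at least d, with equality only for multidegree (1,
    ..., 1). *)
Lemma coef_alternating_sum f k : (k <= d)%N ->
  (\sum_B block_sign B *: scale_blocks B f)`_k
  = if k == d then mlpart [set: 'I_d] f else 0.
Proof.
move=> le_kd; transitivity (\sum_(m <- msupp f)
    f@_m *: (if (k == d) && mlmnm [set: 'I_d] m then 'X_[m] else 0)); last first.
  case: eqP => _ /=; last by rewrite big1 // => m _; rewrite scaler0.
  rewrite /mlpart [RHS]big_mkcond; apply: eq_bigr => m _.
  by case: ifP => // _; rewrite scaler0.
under eq_bigr => B _ do rewrite {1}[f]mpolyE (raddf_sum (scale_blocks B)) scaler_sumr.
rewrite exchange_big coef_sum; apply: eq_bigr => m _ /=.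
under eq_bigr => B _ do rewrite scale_blocksZ scalerA mulrC -scalerA.
rewrite -scaler_sumr coefZ mul_mpolyC alternating_sumX; congr (_ *: _).
case: ifPn => [/forallP m_gt0|].
  rewrite coefZ coefXn.
  have [/forallP m1|m1] := boolP (mlmnm _ _).
    have -> : mdeg m = d by apply: mlmnm_mdeg; apply/forallP.
    by case: eqP; rewrite ?mulr1 ?mulr0.
  rewrite andbF; suff /negPf-> : k != mdeg m by rewrite mulr0.
  apply: contra m1 => /eqP km; apply/forallP => i; rewrite inE.
  have le1 j : true -> (1 <= mblock m j ?= iff (1 == mblock m j))%N.
    by move=> _; split; rewrite ?m_gt0.
  have := leqif_sum le1; rewrite -mdeg_mblock sum1_card card_ord => -[le_d eq_d].
  move: eq_d; rewrite eqn_leq le_d -km le_kd => /esym/forallP/(_ i).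
  by rewrite eq_sym.
rewrite negb_forall coef0 => /existsP[i mi]; rewrite [mlmnm _ _]negbTE ?andbF //.
by apply: contra mi => /forallP/(_ i)/eqP->; rewrite inE.
Qed.

End AlternatingSum.

(** * Truncated geometric series and the Schur complement *)

Definition neumann (R : comNzRingType) r (A : 'M[R]_r) (d : nat) : 'M[R]_r :=
  \sum_(k < d.+1) ((1 - A : 'M[R]_r) ^+ k).

(** If Z is the truncated series, then A Z = 1 - (1 - A)^(d+1); multiplication by adj A on the left
    gives the identity. *)
Lemma adj_neumann (R : comNzRingType) r (A : 'M[R]_r) d :
  \adj A = \det A *: neumann A d + \adj A *m ((1 - A : 'M[R]_r) ^+ d.+1).
Proof.
have AZ : A *m neumann A d = 1%:M - (1 - A : 'M[R]_r) ^+ d.+1.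
  by rewrite -[1%:M]/(1 : 'M[R]_r) -[RHS]opprB subrX1 -mulNr opprB subKr.
by rewrite -mul_scalar_mx -mul_adj_mx -mulmxA AZ mulmxBr mulmx1 subrK.
Qed.

Lemma poly_mx_factorX (R : comNzRingType) a b k (H : 'M[{poly R}]_(a, b)) :
  (forall i j l, (l < k)%N -> (H i j)`_l = 0) ->
  H = 'X^k *: map_mx (drop_poly k) H.
Proof.
move=> H0; apply/matrixP => i j; rewrite !mxE mulrC -[LHS](poly_take_drop k).
rewrite [X in X + _](_ : _ = 0) ?add0r //; apply/polyP => l.
by rewrite coef_take_poly coef0; case: ltnP => // /H0.
Qed.

(** The factors w B vary with B, so each summand is multiplied by the remaining ones to produce the
    common factor W. Since W has constant coefficient 1, the lowest-order term of the alternating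
    sum is unchanged; errors start at order d + 1. *)
Lemma coef_alternating_sum_mod (F : fieldType) d n
    (w : {set 'I_d} -> {poly {mpoly F[d * n]}}) (f g : {mpoly F[d * n]}) k :
  (forall B, (w B)`_0 = 1) ->
  (forall B, exists h, scale_blocks B g = w B * scale_blocks B f - h * 'X^(d.+1)) ->
  (k <= d)%N ->
  (\sum_B (block_sign F n B)%:P * \prod_(B' | B' != B) w B' * scale_blocks B g)`_k
  = if k == d then mlpart [set: 'I_d] f else 0.
Proof.
move=> w0 gf le_kd; pose W := \prod_B w B.
pose S := \sum_B block_sign F n B *: scale_blocks B f.
have [h ->] : exists h, \sum_B (block_sign F n B)%:P * \prod_(B' | B' != B) w B'
    * scale_blocks B g = W * S - h * 'X^(d.+1).
  have exh B : exists h, (block_sign F n B)%:P * \prod_(B' | B' != B) w B' * scale_blocks B g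
      = W * (block_sign F n B *: scale_blocks B f) - h * 'X^(d.+1).
    have [h ->] := gf B; have -> : W = w B * \prod_(B' | B' != B) w B' by rewrite /W (bigD1 B).
    set p := \prod_(_ | _) _; exists ((block_sign F n B)%:P * p * h).
    by rewrite -[block_sign F n B *: _]mul_polyC; ring.
  have [h hE] := fin_all_exists exh.
  exists (\sum_B h B); rewrite mulr_sumr mulr_suml -sumrB.
  by apply: eq_bigr => B _; rewrite -hE.
have W0 : W`_0 = 1.
  by rewrite -horner_coef0 horner_prod big1 // => B _; rewrite horner_coef0.
rewrite coefB coefMXn ltnS le_kd subr0 coefM (bigD1 ord0) //= subn0.
rewrite W0 mul1r coef_alternating_sum // big1 ?addr0 // => l l0.
rewrite coef_alternating_sum ?(leq_trans (leq_subr _ _)) //.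
rewrite ltn_eqF ?mulr0 //; have := ltn_ord l; move: l0; rewrite -val_eqE /=; lia.
Qed.

Section SchurComponent.
Variables (F : fieldType) (d n a b r : nat).
Local Notation P := {mpoly F[d * n]}.
Variables (T : 'M[P]_(a, b)) (Y : 'M[P]_(r, a)) (X : 'M[P]_(b, r)).

Let A := Y *m T *m X.
(** [Q] is the Schur complement with A^-1 truncated, whose multilinear part is wanted; [G] is the
    exact one times det A, whose rank is controlled. *)
Let Q := T - T *m X *m neumann A d *m (Y *m T).
Let G := \det A *: T - T *m X *m \adj A *m (Y *m T).
Let w (B : {set 'I_d}) : {poly P} := scale_blocks B (\det A).

Hypothesis A1 : map_mx (mcoeff 0%MM) A = 1%:M.

Let detA0 : (\det A)@_0%MM = 1.
Proof. by rewrite -det_map_mx A1 det1. Qed.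

(** As A is 1 at the origin, 1 - A has no constant term, so [scale_blocks] makes (1 - A)^(d+1)
    divisible by s^(d+1). *)
Let GE B i j : exists h, scale_blocks B (G i j) = w B * scale_blocks B (Q i j) - h * 'X^(d.+1).
Proof.
pose N : 'M[P]_r := 1 - A.
have [C NC] : exists C, map_mx (scale_blocks B) N = 'X^1 *: C.
  exists (map_mx (drop_poly 1) (map_mx (scale_blocks B) N)).
  apply: poly_mx_factorX => k l [|//] _; rewrite mxE coef0_scale_blocks.
  have N0 : map_mx (mcoeff 0%MM) N = 0 by rewrite map_mxB A1 map_mx1 subrr.
  have := congr1 (fun B : 'M_r => B k l) N0; rewrite mxE [in RHS]mxE => ->.
  by rewrite mpolyC0.
have NdE : map_mx (scale_blocks B) (N ^+ d.+1) = 'X^(d.+1) *: C ^+ d.+1.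
  elim: d.+1 => [|k IH]; first by rewrite !expr0 map_mx1 scale1r.
  by rewrite !exprS -!mulmxE map_mxM IH NC -scalemxAl -scalemxAr scalerA.
pose R := map_mx (scale_blocks B) (T *m X *m \adj A) *m (C ^+ d.+1)
  *m map_mx (scale_blocks B) (Y *m T).
exists (R i j).
have -> : G = \det A *: Q - T *m X *m \adj A *m (N ^+ d.+1) *m (Y *m T).
  rewrite /G {1}[\adj A](adj_neumann A d) /Q scalerBr mulmxDr mulmxDl opprD addrA.
  by rewrite -scalemxAr -scalemxAl !mulmxA.
set R0 := (X in _ - X); have -> : R i j * 'X^(d.+1) = scale_blocks B (R0 i j).
  transitivity (map_mx (scale_blocks B) R0 i j); last by rewrite [LHS]mxE.
  by rewrite 2!map_mxM NdE -scalemxAr -scalemxAl [RHS]mxE mulrC.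
clearbody R0 Q; rewrite -rmorphM -rmorphB; congr (scale_blocks B _).
by rewrite !mxE.
Qed.

Let H : 'M[{poly P}]_(a, b) := \sum_B
  ((block_sign F n B)%:P * \prod_(B' | B' != B) w B') *: map_mx (scale_blocks B) G.

Let coefH i j k : (k <= d)%N ->
  (H i j)`_k = if k == d then mlpart [set: 'I_d] (Q i j) else 0.
Proof.
have w0 B : (w B)`_0 = 1 by rewrite coef0_scale_blocks detA0.
move=> le_kd; rewrite -(coef_alternating_sum_mod w0 (fun B => GE B i j) le_kd) /H summxE.
by congr (nth _ (polyseq _) k); apply: eq_bigr => B _; rewrite mxE [X in _ * X]mxE.
Qed.

(** [H] combines 2^d specializations of [G], each of rank at most rank T - r. It is s^d times a
    matrix whose value at s = 0 is the multilinear part of [Q]. *)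
Lemma fracrank_schur_component :
  (fracrank (map_mx (mlpart [set: 'I_d]) Q) <= 2 ^ d * (fracrank T - r))%N.
Proof.
have rankH : (fracrank H <= 2 ^ d * (fracrank T - r))%N.
  have -> : (2 ^ d = #|{set 'I_d}|)%N by rewrite -cardsT -powersetT card_powerset cardsT card_ord.
  apply: fracrank_sum => B; apply: leq_trans (fracrankZ _ _) _.
  apply: leq_trans (fracrank_map _ _) _.
  have /fracrank_schur : \det A != 0.
    by apply: contra_eq_neq detA0 => ->; rewrite mcoeff0 eq_sym oner_neq0.
  rewrite -/A -/G; move: (fracrank G) (fracrank T) => x y; lia.
clear GE; clearbody H Q; apply: leq_trans rankH; pose H' := map_mx (drop_poly d) H.
have HE : H = 'X^d *: H'.
  apply: poly_mx_factorX => i j l ltl.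
  by rewrite coefH ?(ltnW ltl) // (ltn_eqF ltl).
have -> : map_mx (mlpart [set: 'I_d]) Q = map_mx (horner_eval 0) H'.
  apply/matrixP => i j; rewrite mxE [RHS]mxE [X in horner_eval 0 X]mxE /horner_eval.
  by rewrite horner_coef0 coef_drop_poly add0n coefH // eqxx.
apply: leq_trans (fracrank_map _ _) _.
by rewrite HE (fracrankZ_nz H' (monic_neq0 (monicXn _ d))).
Qed.

End SchurComponent.

(** * Partition rank *)

Section PartitionRank.
Variables (F : fieldType) (d n a b : nat).
Local Notation P := {mpoly F[d * n]}.
Implicit Types (M N : 'M[P]_(a, b)) (S : {set 'I_d}).

Lemma partition_decomposition_fin (I : finType) (S : I -> {set 'I_d})
    (u : I -> 'cV[P]_a) (v : I -> 'rV[P]_b) :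
  (forall i, multilinear_mx (S i) (u i)) ->
  (forall i, multilinear_mx (~: S i) (v i)) ->
  partition_decomposition (\sum_i u i *m v i) #|I|.
Proof.
move=> uml vml; exists (S \o enum_val), (u \o enum_val), (v \o enum_val).
split=> [k|k|]; [exact: uml | exact: vml |].
by rewrite (reindex _ (onW_bij _ (@enum_val_bij I))).
Qed.

Lemma partition_decompositionD M N r s :
  partition_decomposition M r -> partition_decomposition N s ->
  partition_decomposition (M + N) (r + s).
Proof.
move=> [S1 [u1 [v1 [u1ml v1ml ->]]]] [S2 [u2 [v2 [u2ml v2ml ->]]]].
pose sel T (x : 'I_r -> T) (y : 'I_s -> T) k :=
  match k with inl i => x i | inr j => y j end.
have := @partition_decomposition_fin ('I_r + 'I_s)%type
  (sel _ S1 S2) (sel _ u1 u2) (sel _ v1 v2).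
by rewrite big_sumType card_sum !card_ord; apply=> -[].
Qed.

Lemma partition_rank_le M r : multilinear_mx [set: 'I_d] M ->
  partition_decomposition M r -> (partition_rank M <= r)%N.
Proof. by move=> /partition_rankP[_]; apply. Qed.

Lemma partition_rank0 : partition_rank (0 : 'M[P]_(a, b)) = 0%N.
Proof.
apply/eqP; rewrite -leqn0; apply: partition_rank_le.
  by move=> i j; rewrite mxE; exists (fun=> 0); rewrite big1 // => J _; rewrite scale0r.
by exists (fun=> finset.set0), (fun=> 0), (fun=> 0); split=> [[]|[]|] //; rewrite big_ord0.
Qed.

Lemma commutative_rank_eq0 M : commutative_rank M = 0%N -> M = 0.
Proof.
move/eqP; rewrite mxrank_eq0 => /eqP M0; apply/matrixP => i j.
have := congr1 (fun N : 'M_(a, b) => N i j) M0; rewrite !mxE => /eqP.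
by rewrite tofrac_eq0 => /eqP.
Qed.

Lemma rank_eval_mx_le M p : (\rank (eval_mx M p) <= commutative_rank M)%N.
Proof.
by rewrite -(mxrank_map (@tofrac F)); apply: fracrank_map.
Qed.

(** M is the multilinear part of T = U V + (T - U V). The product gives one summand for each S and
    each of the r columns of U; the rest gives E. *)
Lemma partition_rank_reduce M (p : 'M[F]_(d, n)) (r := \rank (eval_mx M p)) :
  multilinear_mx [set: 'I_d] M ->
  exists E : 'M[P]_(a, b), [/\ multilinear_mx [set: 'I_d] E,
    (partition_rank M <= 2 ^ d * r + partition_rank E)%N &
    (commutative_rank E <= 2 ^ d * (commutative_rank M - r))%N].
Proof.
move=> Mml; have [Y [X YX]] := row_col_normal (eval_mx M p); rewrite -/r in Y X YX.
pose q k := mxvec p 0 k.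
pose T := map_mx (comp_mpoly (mshift q)) M.
pose Y' := map_mx (@mpolyC (d * n) F) Y; pose X' := map_mx (@mpolyC (d * n) F) X.
(* The shift makes M(p) the constant term of T, so Y M(p) X = 1 is the normalization that the
   truncated series needs. *)
have T0 : map_mx (mcoeff 0%MM) T = eval_mx M p.
  apply/matrixP => i j; rewrite !mxE mcoeff_mshift mevalE; apply: eq_bigr => k _.
  by congr (_ * _); apply: eq_bigr => l _; rewrite mnm0E -horner_coef0 !hornerE.
have A1 : map_mx (mcoeff 0%MM) (Y' *m T *m X') = 1%:M.
  rewrite !map_mxM T0 -YX; congr (_ *m _ *m _);
    by apply/matrixP => i j; rewrite !mxE /= mcoeffC eqxx mulr1.
pose U := T *m X' *m neumann (Y' *m T *m X') d; pose V := Y' *m T.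
pose E := map_mx (mlpart [set: 'I_d]) (T - U *m V).
have Eml : multilinear_mx [set: 'I_d] E by move=> i j; rewrite mxE; apply: multilinear_mlpart.
exists E; split=> //; last first.
  apply: leq_trans (fracrank_schur_component A1) _.
  by rewrite leq_mul2l leq_sub2r ?orbT //; apply: fracrank_map.
have ME : M = (\sum_(Sk : {set 'I_d} * 'I_r) col Sk.2 (map_mx (mlpart Sk.1) U)
    *m row Sk.2 (map_mx (mlpart (~: Sk.1)) V)) + E.
  apply/matrixP => i j.
  have -> : M i j = mlpart [set: 'I_d] (T i j) by rewrite mxE mlpart_mshift.
  rewrite -[T in LHS](addrNK (U *m V)) [X in mlpart _ X]mxE raddfD /= addrC [RHS]mxE.
  congr (_ + _); last by rewrite [RHS]mxE.
  rewrite summxE mxE raddf_sum /= -(pair_bigA _ (fun S k => (col k (map_mx (mlpart S) U)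
    *m row k (map_mx (mlpart (~: S)) V)) i j)) /= exchange_big /=.
  apply: eq_bigr => k _; rewrite mlpartM; apply: eq_bigr => S _.
  by rewrite [RHS]mxE big_ord1 !mxE.
have [_ leE] := partition_rankP Eml.
apply: partition_rank_le => //; rewrite {1}ME.
have -> : (2 ^ d * r = #|{: {set 'I_d} * 'I_r}|)%N.
  by rewrite card_prod card_ord -cardsT -powersetT card_powerset cardsT card_ord.
apply: partition_decompositionD; last by have [] := partition_rankP Eml.
by apply: partition_decomposition_fin => -[S k] i j; rewrite !mxE; apply: multilinear_mlpart.
Qed.

End PartitionRank.

(** The loss c - r is at most d c / q, so CR(E) <= 2^d d c / q <= c / 2. Iteration sums the
    geometric series 2^d (c + c/2 + ...). *)
Lemma partition_rank_crude_large (F : fieldType) d (S : seq F) :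
  uniq S -> (0 < size S)%N -> (d * 2 ^ d.+1 <= size S)%N ->
  forall n a b (M : 'M[{mpoly F[d * n]}]_(a, b)), multilinear_mx [set: 'I_d] M ->
  (partition_rank M <= 2 ^ d.+1 * commutative_rank M)%N.
Proof.
move=> uS S0 leS n a b M; have [k] := ubnP (commutative_rank M).
elim: k M => // k IH M ltk Mml.
have [/commutative_rank_eq0->|c0] := posnP (commutative_rank M).
  by rewrite partition_rank0.
have [p [_ le_r]] := commutative_rank_grid Mml uS S0.
have [E [Eml le_pr le_E]] := partition_rank_reduce p Mml.
have le_c := rank_eval_mx_le M p.
have le_half : (2 * commutative_rank E <= commutative_rank M)%N.
  have : (size S * (commutative_rank M - \rank (eval_mx M p)) <= d * commutative_rank M)%N.
    by rewrite mulnBr leq_subLR.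
  move: le_E le_c leS S0; rewrite expnS; move: (2 ^ d)%N (size S) => D q.
  move: (commutative_rank M) (commutative_rank E) (\rank _) => c e r.
  move=> le_e le_rc le_q q0; move: (leq_sub2l c (leq0n r)); rewrite subn0.
  move: (c - r)%N le_e => x le_e _ le_x.
  (* For d = 0 the lower bound on q says nothing, but q x <= 0 gives x = 0. *)
  have [d0|d0] := posnP d; first by nia.
  have : (d * (2 * (D * x)) <= d * c)%N by nia.
  rewrite leq_pmul2l //; lia.
have := IH E _ Eml; move: le_pr le_half; rewrite expnS; move: (2 ^ d)%N => D.
move: (commutative_rank E) (partition_rank E) (partition_rank M) le_c c0 ltk => e x y.
move: (commutative_rank M) (\rank _) => c r; nia.
Qed.

(** * Quadratic extensions *)

(** In every characteristic x^2 + x agrees at 0 and -1, so on a finite field it misses some c and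
    X^2 + X - c is irreducible. [t] is the class of X; [p0], [p1] are the coordinates in the basis
    1, t. *)
Lemma quadratic_extension (F : fieldType) (s : seq F) : (forall x, x \in s) ->
  exists (L : fieldType) (iota : {rmorphism F -> L}) (t : L) (p0 p1 : L -> F),
    [/\ forall z, z = iota (p0 z) + iota (p1 z) * t,
        forall x y, p0 (iota x + iota y * t) = x &
        forall x y, p1 (iota x + iota y * t) = y].
Proof.
move=> sF; pose g (x : F) := x ^+ 2 + x.
have [c gc] : exists c, forall x, g x != c.
  pose s' := [seq x <- undup s | x != 0].
  have /allPn[c _ cg] : ~~ all (mem (map g s')) (undup s).
    apply/negP => /allP gs; have := uniq_leq_size (undup_uniq s) gs.
    rewrite size_map size_filter leqNgt => /negP; apply.
    by rewrite -(count_predC (pred1 0)) -[X in (X < _)%N]add0n ltn_add2r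
      -has_count has_pred1 mem_undup.
  exists c => x; apply: contraNneq cg => <-; rewrite inE.
  have [->|x0] := eqVneq x 0; last by rewrite map_f // mem_filter x0 mem_undup sF.
  have -> : g 0 = g (- 1) by rewrite /g; ring.
  by rewrite map_f // mem_filter oppr_eq0 oner_neq0 mem_undup sF.
pose h : {poly F} := 'X^2 + ('X - c%:P).
have sh : size h = 3 by rewrite size_polyDl size_polyXn // size_XsubC.
have mh : h \is monic.
  by rewrite monicE lead_coefDl ?lead_coefXn // size_polyXn size_XsubC.
have ih : irreducible_poly h.
  apply: cubic_irreducible; rewrite ?sh // => x.
  by rewrite /root !hornerE /= subr_eq0 gc.
have hI : monic_irreducible_poly h by [].
pose L : fieldType := {poly %/ h with hI}.
have mkh : mk_monic h = h by apply: mk_monicE.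
exists L, (in_alg L), (in_qpoly h 'X : L).
exists (fun z : L => (z : {poly F})`_0), (fun z : L => (z : {poly F})`_1).
have valE x y : (in_alg L x + in_alg L y * (in_qpoly h 'X : L) : L) = x%:P + y *: 'X :> {poly F}.
  rewrite mulr_algl; transitivity (x *: 1 + y *: polyn (in_qpoly h 'X)) => //.
  by rewrite in_qpoly_small ?mkh ?sh ?size_polyX // alg_polyC.
split=> [z|x y|x y].
- apply: val_inj; apply: etrans (esym (valE _ _)); apply/polyP => i.
  rewrite coefD coefC coefZ coefX; case: i => [|[|i]] /=.
  + by rewrite mulr0 addr0.
  + by rewrite mulr1 add0r.
  by rewrite mulr0 addr0 nth_default // (leq_trans (size_npoly z)) // mkh sh.
- apply: etrans (congr1 (fun p : {poly F} => p`_0) (valE x y)) _.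
  by rewrite coefD coefC coefZ coefX mulr0 addr0.
apply: etrans (congr1 (fun p : {poly F} => p`_1) (valE x y)) _.
by rewrite coefD coefC coefZ coefX mulr1 add0r.
Qed.

(** * Descent of decompositions along a quadratic extension *)

Section Descent.
Variables (F L : fieldType) (iota : {rmorphism F -> L}) (t : L) (p0 p1 : L -> F).
Hypothesis pE : forall z, z = iota (p0 z) + iota (p1 z) * t.
Hypothesis p0K : forall x y, p0 (iota x + iota y * t) = x.
Hypothesis p1K : forall x y, p1 (iota x + iota y * t) = y.

Let p0D z w : p0 (z + w) = p0 z + p0 w.
Proof.
rewrite {1}[z]pE {1}[w]pE -[RHS](p0K _ (p1 z + p1 w)) !rmorphD; congr p0; ring.
Qed.

Let p0Z x z : p0 (iota x * z) = x * p0 z.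
Proof.
rewrite {1}[z]pE -[RHS](p0K _ (x * p1 z)) !rmorphM; congr p0; ring.
Qed.

Let p0_0 : p0 0 = 0.
Proof. by rewrite -[0 in LHS](mulr0 (iota 0)) -(rmorph0 iota) p0Z mul0r. Qed.

Let p1_0 : p1 0 = 0.
Proof. by rewrite -[RHS](p1K 0 0) rmorph0 mul0r addr0. Qed.

Let coefmap (p : L -> F) k (f : {mpoly L[k]}) : {mpoly F[k]} :=
  \sum_(m <- msupp f) p f@_m *: 'X_[m].

Let mcoeff_coefmap p k (f : {mpoly L[k]}) m : p 0 = 0 -> (coefmap p f)@_m = p f@_m.
Proof.
move=> p_0; rewrite raddf_sum /=; under eq_bigr do rewrite mcoeffZ mcoeffX.
have [mf|/memN_msupp_eq0 fm] := boolP (m \in msupp f).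
  rewrite (bigD1_seq m) ?msupp_uniq //= eqxx mulr1 big1 ?addr0 // => l /negPf->.
  by rewrite mulr0.
rewrite fm p_0 big1 // => l _; case: eqP => [->|_]; rewrite ?fm ?p_0 ?mul0r ?mulr0 //.
Qed.

(** With u = u0 + u1 t, one has u v = u0 v + u1 (t v), and [p0] is F-linear. *)
Let coefmapM k (u v : {mpoly L[k]}) :
  coefmap p0 (u * v) = coefmap p0 u * coefmap p0 v + coefmap p1 u * coefmap p0 (t *: v).
Proof.
have p0_sum I (r : seq I) (P : pred I) (z : I -> L) :
    p0 (\sum_(i <- r | P i) z i) = \sum_(i <- r | P i) p0 (z i).
  exact: (big_morph p0 p0D p0_0).
apply/mpolyP => m; rewrite mcoeffD !mcoeffM mcoeff_coefmap // mcoeffM p0_sum -big_split.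
apply: eq_bigr => l _; rewrite !mcoeff_coefmap // mcoeffZ /= {1}[u@__]pE mulrDl p0D p0Z.
by rewrite -mulrA p0Z.
Qed.

Let multilinear_coefmap p d n (S : {set 'I_d}) (f : {mpoly L[d * n]}) :
  p 0 = 0 -> multilinear S f -> multilinear S (coefmap p f).
Proof.
move=> p_0 /multilinearP ml_f; apply/multilinearP => m.
rewrite mcoeff_msupp mcoeff_coefmap // => pm; apply: ml_f; rewrite mcoeff_msupp.
by apply: contra_neq pm => ->.
Qed.

(** Applying [p0] to a decomposition over L recovers M and turns each summand into two over F with
    the same S. *)
Lemma partition_rank_descent d n a b (M : 'M[{mpoly F[d * n]}]_(a, b)) :
  multilinear_mx [set: 'I_d] M ->
  [/\ multilinear_mx [set: 'I_d] (map_mx (map_mpoly iota) M),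
    (commutative_rank (map_mx (map_mpoly iota) M) <= commutative_rank M)%N &
    (partition_rank M <= 2 * partition_rank (map_mx (map_mpoly iota) M))%N].
Proof.
move=> Mml.
have M'ml : multilinear_mx [set: 'I_d] (map_mx (map_mpoly iota) M).
  move=> i j; rewrite mxE; apply/multilinearP => m; rewrite mcoeff_msupp mcoeff_map_mpoly.
  have /multilinearP ml_ij := Mml i j; rewrite fmorph_eq0 -mcoeff_msupp; exact: ml_ij.
split=> //; first exact: fracrank_map.
have [[S [u [v [uml vml ME]]]] _] := partition_rankP M'ml.
set r := partition_rank _ in S u v uml vml ME *.
apply: partition_rank_le => //.
have -> : M = \sum_(ke : 'I_r * bool)
    map_mx (@coefmap (if ke.2 then p1 else p0) (d * n)) (u ke.1) *m
    map_mx (@coefmap p0 (d * n)) ((if ke.2 then t%:MP else 1) *: v ke.1).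
  rewrite -(pair_bigA _ (fun k (e : bool) => map_mx (@coefmap (if e then p1 else p0) (d * n)) (u k)
    *m     map_mx (@coefmap p0 (d * n)) ((if e then t%:MP else 1) *: v k))) /=.
  apply/matrixP => i j; have := congr1 (fun N : 'M_(a, b) => coefmap p0 (N i j)) ME.
  rewrite mxE (_ : coefmap p0 _ = M i j); last first.
    apply/mpolyP => m; rewrite mcoeff_coefmap // mcoeff_map_mpoly.
    by rewrite -[X in p0 X]addr0 -(mul0r t) -(rmorph0 iota) p0K.
  move=> ->; rewrite !summxE.
  have coefmap_sum (f : 'I_r -> {mpoly L[d * n]}) :
      coefmap p0 (\sum_k f k) = \sum_k coefmap p0 (f k).
    apply: (big_morph _ (fun f g => _)) => [f' g|]; apply/mpolyP => m.
      by rewrite mcoeffD !mcoeff_coefmap // mcoeffD p0D.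
    by rewrite mcoeff_coefmap // !mcoeff0 p0_0.
  rewrite coefmap_sum; apply: eq_bigr => k _.
  rewrite big_bool /= !mxE !big_ord1 !mxE coefmapM mul1r addrC mul_mpolyC //.
have -> : (2 * r = #|{: 'I_r * bool}|)%N by rewrite card_prod card_ord card_bool mulnC.
apply: (@partition_decomposition_fin _ _ _ _ _ _ (fun ke : 'I_r * bool => S ke.1)).
  by move=> [k e] i j; rewrite mxE; apply: multilinear_coefmap; [case: e | exact: uml].
move=> [k e] i j; rewrite mxE; apply: multilinear_coefmap => //.
rewrite mxE; case: e; rewrite ?mul1r; last exact: vml.
have /multilinearP ml_v := vml k i j.
apply/multilinearP => m; rewrite mul_mpolyC => /msuppZ_le; exact: ml_v.
Qed.

End Descent.

(** * The crude bound over all fields *)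

Lemma seq_of_size (F : fieldType) : ~ (exists s : seq F, forall x, x \in s) ->
  forall k, exists2 s : seq F, uniq s & size s = k.
Proof.
move=> infF; elim=> [|k [s us sk]]; first by exists [::].
have [x xs] : exists x, x \notin s.
  apply: contra_notP infF => nx; exists s => x; apply: contra_notT nx => xs.
  by exists x.
by exists (x :: s); rewrite /= ?xs ?us ?sk.
Qed.

(** Each quadratic extension at least squares the available grid and costs a factor 2; t of them
    reach size #|S|^(2^t). *)
Lemma partition_rank_crude d t (F : fieldType) (S : seq F) :
  uniq S -> (1 < size S)%N -> (d * 2 ^ d.+1 <= size S ^ (2 ^ t))%N ->
  forall n a b (M : 'M[{mpoly F[d * n]}]_(a, b)), multilinear_mx [set: 'I_d] M ->
  (partition_rank M <= 2 ^ t * (2 ^ d.+1 * commutative_rank M))%N.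
Proof.
elim: t F S => [|t IH] F S uS S1 leS n a b M Mml.
  by rewrite mul1n (partition_rank_crude_large uS (ltnW S1)).
have [[s sF]|infF] := pselect (exists s : seq F, forall x, x \in s); last first.
  (* The successor keeps the grid nonempty when d = 0. *)
  have [S' uS' sS'] := seq_of_size infF (d * 2 ^ d.+1).+1.
  have := @partition_rank_crude_large F d S' uS' _ _ n a b M Mml; rewrite sS' => /(_ isT) le_pr.
  by apply: leq_trans (le_pr _) _; rewrite // leq_pmull // expn_gt0.
have [L [iota [u [p0 [p1 [pE p0K p1K]]]]]] := quadratic_extension sF.
(* This is all of L, of size the square of the cardinality of F. *)
pose S' := [seq iota x + iota y * u | x <- undup s, y <- undup s].
have uS' : uniq S'.
  apply: allpairs_uniq; rewrite ?undup_uniq // => -[x y] [x' y'] _ _ /= e.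
  by rewrite -(p0K x y) -{2}(p1K x y) e p0K p1K.
have sS : (size S <= size (undup s))%N.
  by apply: uniq_leq_size => // x _; rewrite mem_undup.
have sS' : size S' = (size (undup s) ^ 2)%N by rewrite size_allpairs.
have [M'ml leCR lePR] := partition_rank_descent pE p0K p1K Mml.
have S'1 : (1 < size S')%N by rewrite sS' -(exp1n 2) ltn_exp2r // (leq_trans S1).
have leS' : (d * 2 ^ d.+1 <= size S' ^ (2 ^ t))%N.
  by rewrite sS' -expnM -expnS (leq_trans leS) // leq_exp2r ?expn_gt0.
have := IH _ _ uS' S'1 leS' _ _ _ _ M'ml => lePR'.
apply: (leq_trans lePR); rewrite expnS -mulnA leq_mul2l /=.
by apply: (leq_trans lePR'); rewrite !leq_mul2l leCR !orbT.
Qed.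

(** * Constants over finite and infinite fields *)

Theorem theorem1p1 (d : nat) :
  exists K : rat,
    forall (F : fieldType) (n : nat), (0 < n)%N ->
    forall (a b : nat) (M : 'M[{mpoly F[d * n]}]_(a, b)),
      multilinear_mx [set: 'I_d] M ->
      (partition_rank M)%:R
        <= (2 ^+ d + K * inv_card F) * (commutative_rank M)%:R :> rat
      /\
      (commutative_rank M)%:R
        <= (1 - inv_card F) ^- d * (max_rank M)%:R :> rat.
Proof.
(* From the grid {0, 1}, present in every field, Q extensions suffice since Q <= 2^(2^Q); [C] is the
   resulting crude constant. *)
pose Q := (d * 2 ^ d.+1)%N; pose C := (2 ^ Q * 2 ^ d.+1)%N.
(* The loss c - r is at most d c / q and is charged at the rate C 2^d. *)
exists (C * 2 ^ d * d)%:R => F n _ a b M Mml.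
have [_ le_max] := max_rankP M.
have crude (E : 'M[{mpoly F[d * n]}]_(a, b)) : multilinear_mx [set: 'I_d] E ->
    (partition_rank E <= C * commutative_rank E)%N.
  rewrite /C -mulnA; apply: (@partition_rank_crude d Q F [:: 0; 1]) => //.
    by rewrite /= inE eq_sym oner_neq0.
  by rewrite -/Q (leq_trans (ltnW (ltn_expl Q (ltnSn 1)))) // leq_exp2l // ltnW // ltn_expl.
(* The rank at p is charged at the rate 2^d; only the remainder E pays the crude constant. *)
have main p : (partition_rank M <= 2 ^ d * \rank (eval_mx M p)
    + C * 2 ^ d * (commutative_rank M - \rank (eval_mx M p)))%N.
  have [E [Eml le_pr le_E]] := partition_rank_reduce p Mml.
  apply: leq_trans le_pr _; rewrite leq_add2l; apply: leq_trans (crude E Eml) _.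
  by rewrite -mulnA leq_mul2l le_E orbT.
rewrite /inv_card; case: asboolP => [finF|infF]; last first.
  (* With q = d c + 1 points, q (c - r) <= d c < q forces r = c. *)
  have [|S uS sS] := @seq_of_size F _ (d * commutative_rank M).+1.
    by case=> s sF; apply/infF/finite_seqP; exists s; apply/seteqP; split=> x _ //=.
  have [p [_ le_c]] := commutative_rank_grid Mml uS (leq_trans (ltn0Sn _) (eq_leq (esym sS))).
  have {}le_c : (commutative_rank M <= \rank (eval_mx M p))%N.
    rewrite sS in le_c; rewrite leqNgt; apply/negP => lt_r; move: le_c; rewrite leqNgt => /negP; apply.
    by have := leq_mul (leqnn (d * commutative_rank M).+1) lt_r; rewrite mulnS; lia.
  rewrite mulr0 addr0 subr0 expr1n invr1 mul1r -natrX -natrM !ler_nat.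
  split; last exact: leq_trans le_c (le_max p).
  have := main p; rewrite (eqP (_ : _ - _ == 0)%N) ?subn_eq0 // muln0 addn0 => le_pr.
  by rewrite (leq_trans le_pr) // leq_mul2l rank_eval_mx_le orbT.
(* Over a finite field the grid is the whole field. *)
set A := fset_set _; set q := #|` A|.
have inA x : x \in (A : seq F) by rewrite -/(x \in A) in_fset_set // mem_setT.
have q1 : (1 < q)%N.
  have uS : uniq [:: 0; 1 : F] by rewrite /= inE eq_sym oner_neq0.
  by apply: (uniq_leq_size uS) => x _; apply: inA.
have q0 : (0 < q)%N by apply: ltnW.
have [p [le1 le2]] := commutative_rank_grid Mml (fset_uniq A) q0.
have qR : 0 < q%:R :> rat by rewrite ltr0n.
have := main p; have := le_max p; have := rank_eval_mx_le M p.
rewrite -/q in le1 le2.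
move: (commutative_rank M) (partition_rank M) (max_rank M) (\rank _) le1 le2.
move=> c x m r le1 le2 le_rc le_rm le_x; split.
  rewrite -(ler_pM2l qR) mulrA mulrDr mulrCA divff ?gt_eqF // mulr1.
  rewrite -natrX -!natrM -natrD -natrM ler_nat.
  have le_loss : (q * (c - r) <= d * c)%N by rewrite mulnBr leq_subLR.
  apply: leq_trans (leq_mul (leqnn q) le_x) _; rewrite mulnDr mulnDl leq_add //.
    by rewrite mulnA leq_mul2l le_rc orbT.
  by rewrite mulnCA -[leqRHS]mulnA leq_mul2l le_loss orbT.
have qd0 : 0 < q%:R ^+ d :> rat by rewrite exprn_gt0.
have E : 1 - q%:R^-1 = q.-1%:R / q%:R :> rat.
  by rewrite -subn1 natrB // mulrBl divff ?gt_eqF // div1r.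
rewrite ler_pdivlMl E expr_div_n; last by rewrite divr_gt0 // exprn_gt0 // ltr0n; lia.
rewrite mulrAC ler_pdivrMr // -!natrX -!natrM ler_nat.
by apply: (leq_trans le1); rewrite mulnC leq_mul2r le_rm orbT.
Qed.
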